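(* Let $\mathbb{K}$ be a field and $R=\mathbb{K}[x_1,\dots,x_d]$. If $\{I_n\}_{n\in\mathbb{N}}$ is an asymptotically stable filtration of monomial ideals of $R$, then: (1) $\lim_{n\to\infty}\frac{\mathrm{reg}(I_n)}{n}$ exists; (2) $\lim_{n\to\infty}\mathrm{depth}(R/I_n)$ exists.
   Context: A filtration of ideals of $R$ is a decreasing chain $\{I_n\}_{n\in\mathbb{N}}$ with $I_0=R$ and $I_nI_k\subseteq I_{n+k}$ for all $n,k\in\mathbb{N}=\{0,1,2,\dots\}$. For a positive integer $m$ let $R^{\frac1m}=\mathbb{K}[x_1^{1/m},\dots,x_d^{1/m}]$, with inclusion $i:R\to R^{\frac1m}$, $i(\underline{x}^{\underline{\alpha}})=(\underline{x}^{m\underline{\alpha}})^{1/m}$. For a monomial ideal $L\subseteq R$, $L^{\frac1m}$ is the ideal of $R^{\frac1m}$ spanned over $\mathbb{K}$ by the elements $(\underline{x}^{\underline{\alpha}})^{1/m}$ with $\underline{x}^{\underline{\alpha}}\in L$. Let $\phi_m^R:R^{\frac1m}\to R$ be the $R$-linear map with $\phi_m^R((\underline{x}^{\underline{\alpha}})^{1/m})=\underline{x}^{\underline{\alpha}/m}$ if $m$ divides every component of $\underline{\alpha}$, and $0$ otherwise; so $\phi_m^R\circ i=\mathrm{id}_R$. A filtration of monomial ideals $\{I_n\}_{n\in\mathbb{N}}$ is asymptotically stable if: (a) the Rees algebra $\bigoplus_{n\in\mathbb{N}}I_nt^n\subset R[t]$ is Noetherian; and (b) there is an unbounded sequence $\{m_f\}_{f\in\mathbb{N}}$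 of positive integers such that for all $n,f\in\mathbb{N}$ and $1\leqslant j\leqslant m_f$ the maps $i$ and $\phi_{m_f}^R$ induce a split injection $\iota:R/I_{n+1}\to R^{\frac1{m_f}}/(I_{nm_f+j})^{\frac1{m_f}}$, i.e. $i(I_{n+1})\subseteq (I_{nm_f+j})^{\frac1{m_f}}$ and $\phi_{m_f}^R((I_{nm_f+j})^{\frac1{m_f}})\subseteq I_{n+1}$, so that the map induced by $\phi^R_{m_f}$ splits the map induced by $i$. $R$ is standard graded with $\mathfrak{m}=(x_1,\dots,x_d)$; depth is with respect to $\mathfrak{m}$. For a finitely generated graded $R$-module $M$, $a_i(M)=\max\{j\mid \mathrm{H}^i_{\mathfrak{m}}(M)_j\neq 0\}$ (with $\max\emptyset=-\infty$) and $\mathrm{reg}(M)=\max\{a_i(M)+i\mid 0\leqslant i\leqslant\dim M\}$. *)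

(* Defs.v *)
From mathcomp Require Import all_boot all_order all_algebra.
From mathcomp Require Import mpoly fraction.
From mathcomp Require Import boolp classical_sets reals constructive_ereal ereal.

Set Implicit Arguments.
Unset Strict Implicit.
Unset Printing Implicit Defensive.

Import Order.TTheory GRing.Theory Num.Theory.
Local Open Scope classical_set_scope.
Local Open Scope ring_scope.

Section Ideals.
Variable A : comNzRingType.
Implicit Types S J G : set A.

(* J is an ideal of the subring S of A. *)
Definition ideal_in S J :=
  [/\ J `<=` S, J 0, (forall p q, J p -> J q -> J (p + q)) &
      forall s p, S s -> J p -> J (s * p)].

Definition is_ideal J := ideal_in setT J.

Definition ideal_gen G : set A := smallest is_ideal G.

Definition prime_ideal J :=
  [/\ is_ideal J, ~ J 1 & forall p q, J (p * q) -> J p \/ J q].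

Definition annihilator J : set A := [set r | forall p, J p -> r * p = 0].

Definition noetherian_subring S :=
  forall J, ideal_in S J -> exists s : seq A,
    (forall p, p \in s -> J p) /\
    (forall p, J p -> exists c : nat -> A,
       (forall k, S (c k)) /\ p = \sum_(k < size s) c k * s`_k).

Definition prime_chain J (n : nat) (P : nat -> set A) :=
  (forall i, (i <= n)%N -> prime_ideal (P i) /\ J `<=` P i) /\
  (forall i, (i < n)%N -> P i `<` P i.+1).

(* Krull dimension of A / J; it is -oo when J = A. *)
Definition dim_quotient (RR : realType) J : \bar RR :=
  ereal_sup [set n%:R%:E | n in [set n : nat | exists P, prime_chain J n P]].

Definition dim_module (RR : realType) J : \bar RR :=
  dim_quotient RR (annihilator J).

Definition rees_algebra (I : nat -> set A) : set {poly A} :=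
  [set p | forall n, I n p`_n].

Definition filtration (I : nat -> set A) :=
  [/\ forall n, is_ideal (I n), I 0%N = setT,
      forall n, I n.+1 `<=` I n &
      forall n k p q, I n p -> I k q -> I (n + k)%N (p * q)].

(* J + (s_0, ..., s_(r-1)); regular_seq J s below is relative to A / J. *)
Definition add_gens J (s : seq A) : set A := ideal_gen (J `|` [set` s]).

Definition regular_seq J (s : seq A) :=
  (forall i, (i < size s)%N -> forall g,
     add_gens J (take i s) (s`_i * g) -> add_gens J (take i s) g) /\
  add_gens J s <> setT.

(* Depth of A / J with respect to the ideal M: the supremum of the lengths of *)
(* the (A / J)-regular sequences in M, and +oo when M (A / J) = A / J.        *)
Definition depth_quotient (RR : realType) (M J : set A) : \bar RR :=
  if `[< ideal_gen (J `|` M) = setT >] then +oo%E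
  else ereal_sup [set (size s)%:R%:E |
         s in [set s : seq A | (forall p, p \in s -> M p) /\ regular_seq J s]].

End Ideals.

Section Monomial.
Variables (K : fieldType) (d : nat).
Notation R := {mpoly K[d]}.
Implicit Types (I L : set R) (F G : {set 'I_d}) (i m : nat) (j : int).

Definition maximal_ideal : set R := ideal_gen (range (fun k : 'I_d => 'X_k)).

Definition monomial_ideal I :=
  exists S : set 'X_{1..d}, I = ideal_gen [set 'X_[a] | a in S].

(* R^(1/m) is encoded as {mpoly K[d]}, its variable 'X_k standing for         *)
(* x_k^(1/m); thus (x^a)^(1/m) is 'X_[a].                                     *)

Definition root_incl m (p : R) : R :=
  \sum_(a <- msupp p) p@_a *: 'X_[(a *+ m)%MM].

Definition root_proj m (p : R) : R :=
  \sum_(a <- msupp p | [forall k, (m %| a k)%N])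
    p@_a *: 'X_[[multinom (a k %/ m)%N | k < d]].

(* L^(1/m), the K-span of the 'X_[a] in R^(1/m) with x^a in L. In the         *)
(* coordinates above this set does not depend on m.                           *)
Definition root_ideal L : set R :=
  [set p | forall a, a \in msupp p -> L 'X_[a]].

Definition asymptotically_stable (I : nat -> set R) :=
  noetherian_subring (rees_algebra I) /\
  exists mf : nat -> nat,
    [/\ forall f, (0 < mf f)%N, forall B, exists f, (B < mf f)%N &
        forall n f k, (1 <= k <= mf f)%N ->
          root_incl (mf f) @` I n.+1 `<=` root_ideal (I (n * mf f + k)%N) /\
          root_proj (mf f) @` root_ideal (I (n * mf f + k)%N) `<=` I n.+1].

Definition homogeneous_of j : set R :=
  [set p | forall a, a \in msupp p -> (mdeg a)%:Z = j].

Definition var_prod F : R := \prod_(k in F) 'X_k.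

(* The degree j part of the localization of the ideal I at var_prod F; since  *)
(* I is torsion free, the localization embeds in the fraction field of R.     *)
Definition localization I F j : set {fraction R} :=
  [set z | exists p n, [/\ I p, homogeneous_of (j + (n * #|F|)%:Z) p &
     z = FracField.tofrac p / FracField.tofrac (var_prod F) ^+ n]].

(* Cech complex of I on x_1, ..., x_d: a cochain of degree i assigns to every *)
(* F with i elements an element of the localization of I at var_prod F.       *)
Definition cech_cochain I i j (c : {set 'I_d} -> {fraction R}) :=
  forall F, #|F| = i -> localization I F j (c F).

Definition cech_diff (c : {set 'I_d} -> {fraction R}) G : {fraction R} :=
  \sum_(k in G) (-1) ^+ #|[pred l in G | (l < k)%N]| * c (G :\ k).

(* H^i_m(I)_j != 0, as cohomology of the Cech complex. For i = 0 there is no  *)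
(* b to choose: the condition on b is void and its differential at set0 is 0. *)
Definition local_cohomology_neq0 I i j :=
  exists c, [/\ cech_cochain I i j c,
    forall G, #|G| = i.+1 -> cech_diff c G = 0 &
    ~ exists b, (forall F, #|F|.+1 = i -> localization I F j (b F)) /\
                (forall F, #|F| = i -> c F = cech_diff b F)].

Variable RR : realType.

Definition a_invariant I i : \bar RR :=
  ereal_sup [set j%:~R%:E | j in [set j : int | local_cohomology_neq0 I i j]].

Definition reg I : \bar RR :=
  ereal_sup [set (a_invariant I i + i%:R%:E)%E |
    i in [set i : nat | (i%:R%:E <= dim_module RR I)%E]].

Definition depth I : \bar RR := depth_quotient RR maximal_ideal I.

End Monomial.

(* Main.v *)
Require Import Defs.
From mathcomp Require Import all_boot all_order all_algebra.
From mathcomp Require Import mpoly fraction.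
From mathcomp Require Import boolp classical_sets reals constructive_ereal ereal.
From mathcomp Require Import topology normedtype.
From mathcomp Require Import zify ring lra.

(* If (N + 1) / (n + 1) <= q <= N / n then x^a lies in I_(n+1) if and only if *)
(* x^(qa) lies in I_(N+1), so that R / I_(n+1) is a direct summand of         *)
(* (R / I_(N+1))^(1/q); given n, such a q exists for all large N.             *)
(* For the depth this shows depth (R / I_(n+1)) >= depth (R / I_N) for all    *)
(* large N, and a sequence of naturals bounded by d with this property is     *)
(* eventually equal to its minimum.                                           *)
(* For the regularity, H^i(I_(n+1))_j != 0 implies H^i(I_(N+1))_(qj) != 0;    *)
(* as q can be chosen close to (N + 1) / (n + 1), the lower limit of          *)
(* reg(I_n) / n is at least every j / n with H^i(I_n)_j != 0, and the upper   *)
(* limit is at most the supremum of these. Noetherianity of the Rees algebra  *)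
(* makes this supremum finite: the exponents of the minimal generators of I_n *)
(* are at most D n, and H^i(I)_j = 0 once j exceeds d times the exponents of  *)
(* the minimal generators of I.                                               *)

Set Implicit Arguments.
Unset Strict Implicit.
Unset Printing Implicit Defensive.

Import Order.TTheory GRing.Theory Num.Theory.
Local Open Scope classical_set_scope.
Local Open Scope ring_scope.

(** * Koszul complexes *)

Section Koszul.
Variables (A : comNzRingType) (d : nat).
Implicit Types (y : 'I_d -> A) (c b : {set 'I_d} -> A) (F G : {set 'I_d}).

Definition below (k : 'I_d) G := #|[pred l in G | (l < k)%N]|.

Definition kdiff y c G : A :=
  \sum_(k in G) (-1) ^+ below k G * (y k * c (G :\ k)).

Definition khomotopy (k : 'I_d) c F : A :=
  if k \in F then 0 else (-1) ^+ below k F * c (k |: F).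

Lemma belowD1 k l G :
  below k G = ((l \in G) && (l < k)%N + below k (G :\ l))%N.
Proof.
rewrite /below (cardD1 l) /=; congr addn.
by apply: eq_card => m; rewrite !inE andbA.
Qed.

Lemma belowD1_id k G : below k (G :\ k) = below k G.
Proof. by rewrite [RHS](belowD1 k k) ltnn andbF. Qed.

Lemma eq_kdiff y c c' G :
  (forall F, #|F|.+1 = #|G| -> c F = c' F) -> kdiff y c G = kdiff y c' G.
Proof.
move=> cc'; apply: eq_bigr => k kG; rewrite cc' //.
by rewrite [RHS](cardsD1 k) kG.
Qed.

Lemma kdiffD y c c' G : kdiff y (fun F => c F + c' F) G = kdiff y c G + kdiff y c' G.
Proof.
by rewrite /kdiff -big_split; apply: eq_bigr => k _ /=; rewrite -!mulrDr.
Qed.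

Lemma kdiffZ y a c G : kdiff y (fun F => a * c F) G = a * kdiff y c G.
Proof.
rewrite /kdiff mulr_sumr; apply: eq_bigr => k _ /=.
by rewrite [in RHS]mulrCA; congr (_ * _); rewrite mulrCA.
Qed.

Lemma kdiffB y c c' G : kdiff y (fun F => c F - c' F) G = kdiff y c G - kdiff y c' G.
Proof.
by rewrite -mulN1r -kdiffZ -kdiffD; apply: eq_kdiff => F _; rewrite mulN1r.
Qed.

Lemma kdiff_sum (I : Type) (r : seq I) y (c : I -> {set 'I_d} -> A) G :
  kdiff y (fun F => \sum_(i <- r) c i F) G = \sum_(i <- r) kdiff y (c i) G.
Proof.
rewrite /kdiff exchange_big /=; apply: eq_bigr => k _.
by rewrite -mulr_sumr -mulr_sumr.
Qed.

Lemma kdiff_set0 y c : kdiff y c finset.set0 = 0.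
Proof. by rewrite /kdiff big_set0. Qed.

Lemma kdiff_kdiff y c G : kdiff y (kdiff y c) G = 0.
Proof.
pose f (k l : 'I_d) : A := (-1) ^+ below k G * (y k *
    ((-1) ^+ below l (G :\ k) * (y l * c (G :\ k :\ l)))).
have fN k l : k \in G -> l \in G -> (l < k)%N -> f l k = - f k l.
  move=> kG lG lk; rewrite /f.
  rewrite (belowD1 k l G) lG lk /=.
  rewrite [below l G](belowD1 l k G) kG [(k < l)%N]ltnNge (ltnW lk) /= add0n.
  rewrite exprS finset.setDDl finset.setUC -finset.setDDl.
  ring.
transitivity (\sum_(k in G) \sum_(l in G | (l < k)%N) f k l +
              \sum_(k in G) \sum_(l in G | (k < l)%N) f k l).
  rewrite -big_split; apply: eq_bigr => k kG /=.
  rewrite /kdiff !mulr_sumr (bigID (fun l : 'I_d => (l < k)%N)) /=.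
  by congr (_ + _); apply: eq_bigl => l; rewrite !inE -val_eqE /=;
    case: (ltngtP l k); rewrite ?andbF ?andbT.
rewrite [X in _ + X](exchange_big_dep (mem G)) /= => [|k l _ /andP[] //].
rewrite -big_split big1 // => k kG /=.
rewrite [X in _ + X](eq_bigl (fun l => (l \in G) && (l < k)%N)) => [|l]; last first.
  by rewrite kG.
by rewrite -big_split big1 // => l /andP[lG lk] /=; rewrite (fN k l) // subrr.
Qed.

Lemma kdiff_khomotopy y k c F :
  kdiff y (khomotopy k c) F + khomotopy k (kdiff y c) F = y k * c F.
Proof.
rewrite {2}/khomotopy; case: ifP => kF.
  rewrite addr0 /kdiff (bigD1 k) //= big1 => [|l /andP[lF lk]]; last first.
    by rewrite /khomotopy !inE eq_sym lk kF !mulr0.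
  rewrite addr0 /khomotopy !inE eqxx /= finset.setD1K // belowD1_id.
  by rewrite mulrCA signrMK.
rewrite /kdiff (big_setU1 k) ?kF //= mulrDr addrCA mulr_sumr -big_split /=.
rewrite finset.setU1K ?kF // -[below k (k |: F)]belowD1_id finset.setU1K ?kF //.
rewrite signrMK big1 ?addr0 // => l lF.
have lk : l != k by apply: contraTneq lF => ->; rewrite kF.
rewrite /khomotopy !inE kF andbF (belowD1 k l F) lF /=.
rewrite [below l (k |: F)](belowD1 l k) finset.setU1K ?kF // !inE eqxx /=.
have -> : (k |: F) :\ l = k |: F :\ l.
  by rewrite finset.setDUl; congr finset.setU; apply/finset.setDidPl;
    rewrite disjoints1 inE eq_sym.
have : (k < l)%N = ~~ (l < k)%N.
  by move: lk; rewrite -val_eqE; case: ltngtP.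
by move=> ->; case: (l < k)%N => /=; rewrite !add0n ?exprS; ring.
Qed.

Definition kvanish y (J : set A) (i : nat) :=
  forall c, (forall G, #|G| = i.+1 -> J (kdiff y c G)) ->
  exists b, forall F, #|F| = i -> J (c F - kdiff y b F).

End Koszul.

(** * Regular sequences and Koszul cohomology *)

Section IdealTheory.
Variable A : comNzRingType.
Implicit Types J : set A.

Lemma ideal0 J : is_ideal J -> J 0.
Proof. by case. Qed.

Lemma idealD J p q : is_ideal J -> J p -> J q -> J (p + q).
Proof. by case=> _ _ JD _; apply: JD. Qed.

Lemma idealMl J a p : is_ideal J -> J p -> J (a * p).
Proof. by case=> _ _ _ JM; apply: JM. Qed.

Lemma idealMr J a p : is_ideal J -> J p -> J (p * a).
Proof. by rewrite mulrC; apply: idealMl. Qed.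

Lemma idealN J p : is_ideal J -> J p -> J (- p).
Proof. by move=> iJ Jp; rewrite -mulN1r; apply: idealMl. Qed.

Lemma idealB J p q : is_ideal J -> J p -> J q -> J (p - q).
Proof. by move=> iJ Jp Jq; apply: idealD => //; apply: idealN. Qed.

Lemma idealBr J p q : is_ideal J -> J q -> J (p - q) -> J p.
Proof. by move=> iJ Jq Jpq; rewrite -(subrK q p); apply: idealD. Qed.

Lemma ideal_sum (I : Type) (r : seq I) (P : pred I) J (f : I -> A) :
  is_ideal J -> (forall i, P i -> J (f i)) -> J (\sum_(i <- r | P i) f i).
Proof.
move=> iJ Jf; elim/big_ind : _ => //; first exact: ideal0.
by move=> p q; apply: idealD.
Qed.

Lemma ideal_setT J : is_ideal J -> J 1 -> J = setT.
Proof.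
by move=> iJ J1; apply/seteqP; split=> // p _; rewrite -(mulr1 p); apply: idealMl.
Qed.

Lemma ideal_gen_ideal (G : set A) : is_ideal (ideal_gen G).
Proof.
split=> //.
- by move=> J [iJ _]; apply: ideal0.
- by move=> p q Gp Gq J GJ; have [iJ _] := GJ; apply: idealD => //; [apply: Gp | apply: Gq].
- by move=> a p _ Gp J GJ; have [iJ _] := GJ; apply: idealMl => //; apply: Gp.
Qed.

Lemma ideal_gen_id J : is_ideal J -> ideal_gen J = J.
Proof. exact: smallest_id. Qed.

Lemma ideal_gen_min (G : set A) J : is_ideal J -> G `<=` J -> ideal_gen G `<=` J.
Proof. exact: smallest_sub. Qed.

Lemma sub_ideal_gen (G : set A) : G `<=` ideal_gen G.
Proof. exact: sub_gen_smallest. Qed.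

Lemma eq_ideal_gen (G G' : set A) :
  G `<=` ideal_gen G' -> G' `<=` ideal_gen G -> ideal_gen G = ideal_gen G'.
Proof.
by move=> GG' G'G; apply/seteqP; split; apply: ideal_gen_min => //; apply: ideal_gen_ideal.
Qed.

Definition ideal_add J (s : A) : set A := [set p | exists a, J (p - a * s)].

Lemma ideal_add_ideal J s : is_ideal J -> is_ideal (ideal_add J s).
Proof.
move=> iJ; split=> //; first by exists 0; rewrite mul0r subr0; apply: ideal0.
  move=> p q [a Ja] [b Jb]; exists (a + b).
  by rewrite mulrDl opprD addrACA; apply: idealD.
by move=> r p _ [a Ja]; exists (r * a); rewrite -mulrA -mulrBr; apply: idealMl.
Qed.

Lemma sub_ideal_add J s : J `<=` ideal_add J s.
Proof. by move=> p Jp; exists 0; rewrite mul0r subr0. Qed.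

Lemma ideal_add_mem J s : is_ideal J -> ideal_add J s s.
Proof. by move=> iJ; exists 1; rewrite mul1r subrr; apply: ideal0. Qed.

Lemma ideal_add_min J J' s : is_ideal J' -> J `<=` J' -> J' s -> ideal_add J s `<=` J'.
Proof.
move=> iJ' JJ' J's p [a /JJ' Jpa].
by apply: idealBr Jpa => //; apply: idealMl.
Qed.

Lemma add_gens_nil J : is_ideal J -> add_gens J [::] = J.
Proof.
move=> iJ; rewrite /add_gens -[RHS]ideal_gen_id //; congr ideal_gen.
by apply/seteqP; split=> p; [case | left].
Qed.

Lemma add_gens_cons J s t : is_ideal J ->
  add_gens J (s :: t) = add_gens (ideal_add J s) t.
Proof.
move=> iJ; apply: eq_ideal_gen => p.
  case=> [Jp|]; first by apply: sub_ideal_gen; left; apply: sub_ideal_add.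
  rewrite /= inE => /orP[/eqP ->|pt]; apply: sub_ideal_gen; last by right.
  by left; apply: ideal_add_mem.
case=> [|pt]; last by apply: sub_ideal_gen; right; rewrite /= inE pt orbT.
apply: ideal_add_min; first exact: ideal_gen_ideal.
  by move=> q Jq; apply: sub_ideal_gen; left.
by apply: sub_ideal_gen; right; rewrite /= mem_head.
Qed.

Definition nonzerodiv J s := forall g, J (s * g) -> J g.

Lemma regular_seq_nil J : is_ideal J -> regular_seq J [::] <-> J <> setT.
Proof. by move=> iJ; rewrite /regular_seq add_gens_nil //; split=> [[]|]. Qed.

Lemma regular_seq_cons J s t : is_ideal J ->
  regular_seq J (s :: t) <-> nonzerodiv J s /\ regular_seq (ideal_add J s) t.
Proof.
move=> iJ; rewrite /regular_seq add_gens_cons //; split.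
  move=> [reg nT]; split; first by move=> g; have /= := reg 0 isT g; rewrite add_gens_nil.
  by split=> // i it g; have /= := reg i.+1 it g; rewrite add_gens_cons.
move=> [nzd [reg nT]]; split=> // -[_|i] /=; first by rewrite add_gens_nil.
by rewrite ltnS => it g; rewrite add_gens_cons //; apply: reg.
Qed.

Section KoszulQuotient.
Variables (d : nat) (y : 'I_d -> A) (J : set A).
Hypothesis iJ : is_ideal J.
Implicit Types (F G : {set 'I_d}) (c b : {set 'I_d} -> A).

Lemma kdiff_ideal c G :
  (forall F, #|F|.+1 = #|G| -> J (c F)) -> J (kdiff y c G).
Proof.
move=> cJ; apply: ideal_sum => // k kG; do 2 apply: idealMl => //; apply: cJ.
by rewrite [RHS](cardsD1 k) kG.
Qed.

Lemma cocycle_nullhomotopic i c s :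
  (forall G, #|G| = i.+1 -> J (kdiff y c G)) ->
  (exists a, s = \sum_k y k * a k) ->
  exists b, forall F, #|F| = i -> J (s * c F - kdiff y b F).
Proof.
move=> cJ [a ->]; exists (fun F => \sum_k a k * khomotopy k c F) => F Fi.
rewrite mulr_suml kdiff_sum -sumrB; apply: ideal_sum => // k _.
rewrite kdiffZ (mulrC (y k)) -mulrA -kdiff_khomotopy -mulrBr addrAC subrr add0r.
apply: idealMl => //; rewrite /khomotopy; case: ifP => kF; first exact: ideal0.
by apply: idealMl => //; apply: cJ; rewrite cardsU1 kF Fi.
Qed.

Lemma kvanish_quotient s r : nonzerodiv J s ->
  (forall i, (i < r.+1)%N -> kvanish y J i) ->
  forall i, (i < r)%N -> kvanish y (ideal_add J s) i.
Proof.
move=> nzd van i ir c cJ.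
have /choice[e Je] : forall G : {set 'I_d}, exists e, #|G| = i.+1 -> J (kdiff y c G - e * s).
  move=> G; have [/cJ[e Je]|/eqP nG] := eqVneq #|G| i.+1; first by exists e.
  by exists 0 => /nG.
have [//||b Jb] := van i.+1 _ e.
  move=> G Gi; apply: nzd; rewrite -kdiffZ -[kdiff _ _ _]opprK; apply: idealN => //.
  rewrite -sub0r -(kdiff_kdiff y c G) -kdiffB; apply: kdiff_ideal => F.
  by rewrite Gi => -[Fi]; rewrite mulrC; apply: Je.
have [||b' Jb'] := van i _ (fun F => c F - s * b F); first exact: ltnW.
  move=> G Gi; rewrite kdiffB kdiffZ.
  have /(idealMl s iJ) := Jb G Gi; have := Je G Gi.
  by move=> /(idealD iJ) /[apply]; rewrite mulrBr [_ * s]mulrC addrA subrK.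
exists b' => F Fi; exists (b F); have := Jb' F Fi.
by rewrite -addrA -opprD [s * _ + _]addrC opprD addrA [s * _]mulrC.
Qed.

End KoszulQuotient.

(* H^i is killed by the ideal (y), hence by a power of s; on the other hand   *)
(* the long exact sequence makes s injective on it.                           *)
Lemma regular_kvanish (d : nat) (y : 'I_d -> A) t J : is_ideal J ->
  regular_seq J t ->
  (forall s, s \in t -> exists N a, s ^+ N = \sum_k y k * a k) ->
  forall i, (i < size t)%N -> kvanish y J i.
Proof.
elim: t J => [//|s t IH] J iJ /(regular_seq_cons _ _ iJ)[nzd reg] st i it c cJ.
have [N /(cocycle_nullhomotopic iJ cJ)] := st s (mem_head _ _).
elim: N => [|N IHN] [b Jb].
  by exists b => F /Jb; rewrite mul1r.
apply: IHN; case: i cJ Jb it => [|i] cJ Jb it.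
  exists b => F F0; apply: nzd; move: (Jb F F0).
  have -> : F = finset.set0 by apply/eqP; rewrite -cards_eq0 F0.
  by rewrite kdiff_set0 !subr0 mulrA -exprS.
have [|||b1 Jb1] := IH _ (ideal_add_ideal s iJ) reg _ i _ b.
- by move=> u ut; apply: st; rewrite inE ut orbT.
- by [].
- move=> G Gi; exists (s ^+ N * c G); rewrite mulrAC -exprSr -opprB.
  by apply: idealN => //; apply: Jb.
have /choice[e Je] : forall F : {set 'I_d}, exists e, #|F| = i -> J (b F - kdiff y b1 F - e * s).
  move=> F; have [/Jb1[e Je]|/eqP nF] := eqVneq #|F| i; first by exists e.
  by exists 0 => /nF.
exists e => F Fi; apply: nzd; rewrite mulrBr mulrA -exprS -kdiffZ.
have : J (kdiff y b F - kdiff y (fun F => s * e F) F).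
  rewrite -[kdiff y b F]subr0 -(kdiff_kdiff y b1 F) -!kdiffB.
  by apply: kdiff_ideal => // G; rewrite Fi => -[Gi]; rewrite [s * _]mulrC; apply: Je.
by move=> /(idealD iJ (Jb F Fi)); rewrite addrA subrK.
Qed.

End IdealTheory.

(** * Associated primes in Noetherian rings *)

Section Noetherian.
Variable A : comNzRingType.
Implicit Types (J M : set A) (u v : A).

Lemma prime_prod (I : Type) (r : seq I) (P : pred I) J (f : I -> A) :
  prime_ideal J -> J (\prod_(i <- r | P i) f i) -> exists2 i, P i & J (f i).
Proof.
move=> [iJ nJ1 pJ]; elim/big_rec: _ => [/nJ1 //|i x Pi IH /pJ[Jfi|/IH //]].
by exists i.
Qed.

Lemma prime_avoidance (I : eqType) (r : seq I) (P : I -> set A) M :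
  is_ideal M -> (forall i, i \in r -> prime_ideal (P i)) ->
  (forall i, i \in r -> ~ M `<=` P i) ->
  exists x, M x /\ forall i, i \in r -> ~ P i x.
Proof.
move=> iM; have [n] := ubnP (size r); elim: n r => // n IH [|i r] /=.
  by exists 0; split=> //; apply: ideal0.
rewrite ltnS => rn prP MP.
have [[j [jr PjPi]]|/forallNP sep] := pselect (exists j, j \in r /\ P j `<=` P i).
  have [|||x [Mx xP]] := IH (i :: rem j r).
  - by rewrite /= size_rem // prednK //; case: (r) jr.
  - by move=> k; rewrite inE => /predU1P[->|/mem_rem kr]; apply: prP; rewrite inE ?eqxx ?kr ?orbT.
  - by move=> k; rewrite inE => /predU1P[->|/mem_rem kr]; apply: MP; rewrite inE ?eqxx ?kr ?orbT.
  exists x; split=> // k; rewrite inE => /predU1P[->|kr]; first by apply: xP; rewrite mem_head.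
  have [->|kj] := eqVneq k j; first by move=> /PjPi; apply: xP; rewrite mem_head.
  apply: xP; rewrite inE; apply/orP; right.
  by have := perm_mem (perm_to_rem jr) k; rewrite kr inE (negPf kj).
have [|||x [Mx xP]] := IH r.
- by [].
- by move=> k kr; apply: prP; rewrite inE kr orbT.
- by move=> k kr; apply: MP; rewrite inE kr orbT.
have [Pix|nPix] := pselect (P i x); last first.
  by exists x; split=> // k; rewrite inE => /predU1P[->//|/xP].
have /choice[f fP] : forall j, exists p, j \in r -> P j p /\ ~ P i p.
  move=> j; case: (boolP (j \in r)) => [jr|_]; last by exists 0.
  have /existsNP[p /not_implyP[Pjp nPip]] : ~ (forall p, P j p -> P i p).
    by move=> jPi; apply: (sep j).
  by exists p.
have [m [Mm nPim]] : exists m, M m /\ ~ P i m.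
  have /existsNP[m /not_implyP[Mm nPim]] : ~ (forall m, M m -> P i m).
    exact: MP (mem_head _ _).
  by exists m.
have pri := prP i (mem_head _ _); have [iPi _ pPi] := pri.
pose z := m * \prod_(j <- r) f j.
have nPiz : ~ P i z.
  move=> /pPi[//|]; rewrite big_seq => /(prime_prod pri)[j jr].
  by have [] := fP j jr.
exists (x + z); split; first by apply: idealD => //; apply: idealMr.
move=> k; rewrite inE => /predU1P[->|kr].
  by move=> Pixz; apply: nPiz; rewrite -(addKr x z) addrC; apply: idealB.
have [iPk _ _] : prime_ideal (P k) by apply: prP; rewrite inE kr orbT.
move=> Pkxz; apply: (xP k kr); rewrite -(addrK z x); apply: idealB => //.
rewrite /z (big_rem k) //=; apply: idealMl => //; apply: idealMr => //.
by have [] := fP k kr.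
Qed.

Hypothesis noeth : noetherian_subring [set: A].

Lemma ideal_maximal (S : set (set A)) J0 : (forall J, S J -> is_ideal J) -> S J0 ->
  exists J, [/\ S J, J0 `<=` J & forall J', S J' -> J `<=` J' -> J' = J].
Proof.
move=> idS SJ0; apply: contrapT => nomax.
have /choice[g gP] : forall J, exists J', S J -> J0 `<=` J ->
    [/\ S J', J `<=` J' & J' <> J].
  move=> J; have [[SJ J0J]|nSJ] := pselect (S J /\ J0 `<=` J); last first.
    by exists J => SJ J0J; case: nSJ.
  apply: contrapT => /forallNP noJ'; apply: nomax; exists J; split=> // J' SJ' JJ'.
  by apply: contrapT => neq; apply: (noJ' J').
pose u n := iter n g J0.
have uP n : S (u n) /\ J0 `<=` u n.
  elim: n => [|n [Sn Jn]]; first by split=> // p.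
  have [SJ' sub _] := gP _ Sn Jn.
  by split=> //; apply: subset_trans sub.
have uS n : u n `<=` u n.+1 by have [Sn Jn] := uP n; have [] := gP _ Sn Jn.
have uM m n : (m <= n)%N -> u m `<=` u n.
  elim: n => [|n IH]; first by rewrite leqn0 => /eqP ->.
  by rewrite leq_eqVlt => /predU1P[->//|/IH sub]; apply: subset_trans (uS n).
pose U := [set p | exists n, u n p].
have iU : ideal_in setT U.
  split=> //; first by exists 0; apply: ideal0; apply: idS.
    move=> p q [m mp] [n nq]; exists (maxn m n); have [Sn _] := uP (maxn m n).
    by apply: idealD; [exact: idS | apply: uM mp; rewrite leq_maxl
                       | apply: uM nq; rewrite leq_maxr].
  by move=> a p _ [n np]; exists n; apply: idealMl => //; apply: idS; have [] := uP n.
have [s [sU sgen]] := noeth iU.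
have [n un] : exists n, forall p, p \in s -> u n p.
  elim: s sU {sgen} => [|p s IH] sU; first by exists 0%N.
  have [n np] := sU p (mem_head _ _).
  have [|m sm] := IH; first by move=> q qs; apply: sU; rewrite inE qs orbT.
  exists (maxn n m) => q; rewrite inE => /predU1P[->|/sm].
    by apply: uM np; rewrite leq_maxl.
  by apply: uM; rewrite leq_maxr.
have [Sn Jn] := uP n; have [_ _] := gP _ Sn Jn; apply.
apply/seteqP; split; last exact: uS.
move=> p /= pn1; have [c [_ ->]] : exists c, (forall k : nat, setT (c k)) /\
   p = \sum_(k < size s) c k * s`_k by apply: sgen; exists n.+1.
apply: ideal_sum => [|k _]; first exact: idS.
by apply: idealMl; [exact: idS | apply/un/mem_nth].
Qed.

Lemma ideal_gen_finite (S : set A) : exists s : seq A,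
  (forall p, p \in s -> S p) /\ S `<=` ideal_gen [set` s].
Proof.
pose T : set (set A) := [set ideal_gen [set` s] | s in
   [set s : seq A | forall p, p \in s -> S p]].
have [J [[s sS <-] _ maxs]] : exists J, [/\ T J, ideal_gen [set` [::]] `<=` J &
    forall J', T J' -> J `<=` J' -> J' = J].
  apply: ideal_maximal => [_ [s _ <-]|]; first exact: ideal_gen_ideal.
  by exists [::].
exists s; split=> // p Sp; rewrite -(maxs (ideal_gen [set` p :: s])).
- by apply: sub_ideal_gen; rewrite /= mem_head.
- by exists (p :: s) => // q; rewrite inE => /predU1P[->//|/sS].
apply: ideal_gen_min; first exact: ideal_gen_ideal.
by move=> q qs; apply: sub_ideal_gen; rewrite /= inE [q \in s]qs orbT.
Qed.

Definition colon J u : set A := [set p | J (p * u)].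

Lemma colon_ideal J u : is_ideal J -> is_ideal (colon J u).
Proof.
move=> iJ; split=> //; rewrite /colon /=.
- by rewrite mul0r; apply: ideal0.
- by move=> p q Jp Jq; rewrite mulrDl; apply: idealD.
- by move=> a p _ Jp; rewrite -mulrA; apply: idealMl.
Qed.

(* The maximal elements of {J : u | u \notin J} are prime; there are finitely *)
(* many of them: if u is a combination of u_1, ..., u_r then the intersection *)
(* of the J : u_i lies in J : u.                                              *)
Lemma nonzerodiv_exists J M : is_ideal J -> is_ideal M ->
  (forall u, (forall m, M m -> J (m * u)) -> J u) ->
  exists2 s, M s & nonzerodiv J s.
Proof.
move=> iJ iM socJ.
pose S : set (set A) := [set colon J u | u in ~` J].
pose maxS u := ~ J u /\ forall v, ~ J v -> colon J u `<=` colon J v ->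
  colon J v = colon J u.
have above v : ~ J v -> exists u, maxS u /\ colon J v `<=` colon J u.
  move=> nJv; have [||P [[u nJu <-] vu umax]] := @ideal_maximal S (colon J v).
  - by move=> _ [u _ <-]; apply: colon_ideal.
  - by exists v.
  by exists u; split=> //; split=> // w nJw; apply: umax; exists w.
have prime_max u : maxS u -> prime_ideal (colon J u).
  move=> [nJu umax]; split; first exact: colon_ideal.
    by rewrite /colon /= mul1r.
  move=> p q Jpqu; have [|nJqu] := pselect (colon J u q); [by right | left].
  rewrite -(umax (q * u)) //; first by rewrite /colon /= mulrA.
  by move=> r Jru; rewrite /colon /= mulrCA; apply: idealMl.
have [s [smax sgen]] := ideal_gen_finite maxS.
have fin u : maxS u -> exists2 v, v \in s & colon J u = colon J v.
  move=> uM; apply: contrapT => nov.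
  have /choice[f fP] : forall v, exists p, v \in s -> colon J v p /\ ~ colon J u p.
    move=> v; have [vs|_] := boolP (v \in s); last by exists 0.
    have [vM vmax] := smax v vs.
    have /existsNP[p /not_implyP[vp nup]] : ~ (forall p, colon J v p -> colon J u p).
      by move=> /vmax uv; apply: nov; exists v => //; apply: uv; have [] := uM.
    by exists p.
  have Jprod : ideal_gen [set` s] `<=` [set w | J ((\prod_(v <- s) f v) * w)].
    apply: ideal_gen_min => [|v vs].
      split=> //=; first by rewrite mulr0; apply: ideal0.
        by move=> p q Jp Jq; rewrite mulrDr; apply: idealD.
      by move=> a p _ Jp; rewrite mulrCA; apply: idealMl.
    rewrite /= (big_rem v) //= mulrAC; apply: idealMr => //.
    by have [] := fP v vs.
  have : colon J u (\prod_(v <- s) f v) by apply: Jprod; apply: sgen.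
  rewrite big_seq => /(prime_prod (prime_max u uM))[v vs].
  by have [] := fP v vs.
have [[v vs Mv]|nM] := pselect (exists2 v, v \in s & M `<=` colon J v).
  by have [nJv _] := smax v vs; case: nJv; apply: socJ.
have [||x [Mx xP]] := @prime_avoidance _ s (colon J) M iM.
- by move=> v /smax /prime_max.
- by move=> v vs Mv; apply: nM; exists v.
exists x => // g Jxg; apply: contrapT => /above[u [/fin[v vs uv] gu]].
by apply: (xP v vs); rewrite -uv; apply: gu.
Qed.

Lemma kvanish_regular (d : nat) (y : 'I_d -> A) r J M : is_ideal J -> is_ideal M ->
  (forall k, M (y k)) -> ~ M 1 -> J `<=` M ->
  (forall i, (i < r)%N -> kvanish y J i) ->
  exists t, [/\ size t = r, forall s, s \in t -> M s & regular_seq J t].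
Proof.
move=> iJ iM My nM1; elim: r J iJ => [|r IH] J iJ JM van.
  by exists [::]; split=> //; apply/regular_seq_nil => // JT; apply/nM1/JM; rewrite JT.
have [|s Ms nzd] := @nonzerodiv_exists J M iJ iM.
  move=> u uM; have [//||b /(_ finset.set0)] := van 0%N _ (fun=> u).
    by move=> G _; apply: ideal_sum => // k _; apply: idealMl => //; apply: uM.
  by rewrite cards0 kdiff_set0 subr0; apply.
have [|||t [tr tM treg]] := IH (ideal_add J s).
- exact: ideal_add_ideal.
- exact: ideal_add_min.
- by move=> i ir; apply: kvanish_quotient ir.
exists (s :: t); split=> [||]; first by rewrite /= tr.
  by move=> p; rewrite inE => /predU1P[->|/tM].
by apply/regular_seq_cons.
Qed.

End Noetherian.

(** * Hilbert's basis theorem for {mpoly K[d]} *)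

Section LinearCombinations.
Variable A : comNzRingType.

Lemma lincomb_ideal (I : finType) (y : I -> A) :
  is_ideal [set p | exists a, p = \sum_i y i * a i].
Proof.
split=> //=.
- by exists (fun=> 0); rewrite big1 // => i _; rewrite mulr0.
- move=> p q [a ->] [b ->]; exists (fun i => a i + b i).
  by rewrite -big_split; apply: eq_bigr => i _; rewrite mulrDr.
- move=> s p _ [a ->]; exists (fun i => s * a i).
  by rewrite mulr_sumr; apply: eq_bigr => i _; rewrite mulrCA.
Qed.

Lemma lincomb_mem (I : finType) (y : I -> A) i : exists a, y i = \sum_i y i * a i.
Proof.
exists (fun j => (j == i)%:R); rewrite (bigD1 i) //= eqxx mulr1 big1 ?addr0 //.
by move=> j /negPf->; rewrite mulr0.
Qed.

Lemma ideal_gen_seq (s : seq A) p : ideal_gen [set` s] p ->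
  exists c : nat -> A, p = \sum_(k < size s) c k * s`_k.
Proof.
move=> /(ideal_gen_min (lincomb_ideal (fun k : 'I_(size s) => s`_k)))[q /= qs|a ->].
  have qi : (index q s < size s)%N by rewrite index_mem.
  by have := lincomb_mem (fun k : 'I_(size s) => s`_k) (Ordinal qi); rewrite nth_index.
exists (fun k => if insub k is Some i then a i else 0).
by apply: eq_bigr => i _; rewrite valK mulrC.
Qed.

End LinearCombinations.

Lemma dickson d (E : set 'X_{1..d}) : exists s : seq 'X_{1..d},
  (forall a, a \in s -> E a) /\
  forall a, E a -> exists2 b, b \in s & (b <= a)%MM.
Proof.
suff /(_ d E)[s [sE Es]] : forall k (E : set 'X_{1..d}), exists s : seq 'X_{1..d},
    (forall a, a \in s -> E a) /\ forall a, E a ->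
    exists2 b, b \in s & forall i : 'I_d, (i < k)%N -> (b i <= a i)%N.
  by exists s; split=> // a /Es[b bs ba]; exists b => //; apply/mnm_lepP => i; apply: ba.
elim=> [{}E|k IH {}E].
  have [[a Ea]|/forallNP nE] := pselect (exists a, E a).
    by exists [:: a]; split=> [b|b _]; [rewrite inE => /eqP->|exists a; rewrite ?mem_head].
  by exists [::]; split=> // a /nE.
have [s0 [s0E Es0]] := IH E.
have [kd|dk] := ltnP k d; last first.
  exists s0; split=> // a /Es0[b bs ba]; exists b => // i _; apply: ba.
  exact: leq_trans dk.
pose i0 := Ordinal kd; pose N := (\sum_(b <- s0) b i0)%N.
have /choice[s sP] : forall v : nat, exists s : seq 'X_{1..d},
    (forall a, a \in s -> E a /\ a i0 = v) /\ forall a, E a /\ a i0 = v ->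
    exists2 b, b \in s & forall i : 'I_d, (i < k)%N -> (b i <= a i)%N.
  by move=> v; have [s [sE Es]] := IH [set a | E a /\ a i0 = v]; exists s.
exists (s0 ++ flatten [seq s v | v <- iota 0 N]); split=> a.
  rewrite mem_cat => /orP[/s0E//|/flatten_mapP[v _ /(proj1 (sP v))]]; by case.
move=> Ea; have [aN|Na] := ltnP (a i0) N.
  have [b bs ba] := proj2 (sP (a i0)) a (conj Ea erefl).
  exists b; first by rewrite mem_cat; apply/orP; right; apply/flatten_mapP;
    exists (a i0); rewrite ?mem_iota.
  move=> i; rewrite ltnS leq_eqVlt => /orP[/eqP ik|]; last exact: ba.
  have -> : i = i0 by apply: val_inj.
  by have [_ ->] := proj1 (sP (a i0)) b bs.
have [b bs ba] := Es0 a Ea; exists b; first by rewrite mem_cat bs.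
move=> i; rewrite ltnS leq_eqVlt => /orP[/eqP ik|]; last exact: ba.
have -> : i = i0 by apply: val_inj.
by apply: leq_trans Na; rewrite /N (big_rem b) //= leq_addr.
Qed.

Section Hilbert.
Variables (K : fieldType) (d : nat).
Notation R := {mpoly K[d]}.

Lemma noetherian_mpoly : noetherian_subring [set: R].
Proof.
move=> J iJ.
pose E := [set mlead p | p in [set p | J p /\ p != 0]].
have [s [sE Es]] := dickson E.
have /choice[g gP] : forall b, exists p, b \in s -> [/\ J p, p != 0 & mlead p = b].
  move=> b; have [/sE[p [Jp p0] pb]|_] := boolP (b \in s); last by exists 0.
  by exists p.
exists [seq g b | b <- s]; split=> [p /mapP[b bs ->]|p Jp]; first by have [] := gP b bs.
suff /ideal_gen_seq[c ->] : ideal_gen [set` [seq g b | b <- s]] p by exists c.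
elim/mleadrect: p Jp => p IH Jp; set L := ideal_gen _.
have iL : is_ideal L by apply: ideal_gen_ideal.
have [->|p0] := eqVneq p 0; first exact: (ideal0 iL).
have [b bs bp] : exists2 b, b \in s & (b <= mlead p)%MM by apply: Es; exists p.
have [Jg g0 gb] := gP b bs.
pose h : R := (p@_(mlead p) / (g b)@_b) *: 'X_[mlead p - b] * g b.
have Lh : L h by apply: (idealMl _ iL); apply: sub_ideal_gen; apply: map_f.
apply: (idealBr iL Lh).
have [->|q0] := eqVneq (p - h) 0; first exact: (ideal0 iL).
apply: IH; last by apply: (idealB iJ) => //; apply: (idealMl _ iJ).
have gb0 : (g b)@_b != 0 by rewrite -[X in _@_X]gb mleadc_eq0.
have leadX : mlead ('X_[mlead p - b] * g b) = mlead p.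
  rewrite mleadM_proper ?mleadXm ?gb ?submK // mcoeffX eqxx mul1r.
  by rewrite gb0.
have hE : h = (p@_(mlead p) / (g b)@_b) *: ('X_[mlead p - b] * g b).
  by rewrite /h scalerAl.
rewrite lt_neqAle; apply/andP; split; last first.
  apply: le_trans (mleadB_le _ _) _; rewrite leUx lexx /= hE.
  by rewrite (le_trans (mleadZ_le _ _)) ?leadX.
apply: contra_neq q0 => eqm; apply/eqP; rewrite -mleadc_eq0 eqm.
have cE : ('X_[mlead p - b] * g b)@_(mlead p) = (g b)@_b.
  by rewrite -[RHS](mcoeffMX _ (mlead p - b)) submK // mulrC.
by rewrite mcoeffB hE mcoeffZ cE mulfVK ?subrr.
Qed.

End Hilbert.

(** * Monomial ideals and roots *)

Section MonomialIdeals.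
Variables (K : fieldType) (d : nat).
Notation R := {mpoly K[d]}.
Implicit Types (I J : set R) (p q r : R) (a b c e : 'X_{1..d}).

Lemma mpoly_ideal_supp J p : is_ideal J ->
  (forall a, a \in msupp p -> J 'X_[a]) -> J p.
Proof.
move=> iJ Jp; rewrite (mpolyE p) big_seq; apply: ideal_sum => // a /Jp Ja.
by rewrite -mul_mpolyC; apply: idealMl.
Qed.

Lemma monomial_is_ideal I : monomial_ideal I -> is_ideal I.
Proof. by move=> [S ->]; apply: ideal_gen_ideal. Qed.

Lemma monomial_ideal_supp I p : monomial_ideal I ->
  I p <-> (forall a, a \in msupp p -> I 'X_[a]).
Proof.
move=> mI; have iI := monomial_is_ideal mI; split; last exact: mpoly_ideal_supp.
case: mI => S IS; rewrite {1}IS.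
suff : ideal_gen [set 'X_[a] | a in S] `<=` [set p : R | forall a, a \in msupp p -> I 'X_[a]].
  exact.
apply: ideal_gen_min => [|_ [a Sa <-] b]; last first.
  by rewrite msuppX mem_seq1 => /eqP->; rewrite IS; apply: sub_ideal_gen; exists a.
split=> //= [a|p1 p2 Ip1 Ip2 a|r p1 _ Ip1 a]; first by rewrite msupp0.
  by move=> /msuppD_le; rewrite mem_cat => /orP[/Ip1|/Ip2].
move=> /msuppM_le /allpairsP[[a1 a2] /= [_ /Ip1 Ia2 ->]].
by rewrite mpolyXD; apply: idealMl.
Qed.

Lemma monomial_ideal_le I a b : is_ideal I -> (a <= b)%MM -> I 'X_[a] -> I 'X_[b].
Proof. by move=> iI ab Ia; rewrite -(submK ab) mpolyXD; apply: idealMl. Qed.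

Lemma maximal_idealP p : maximal_ideal p <-> p@_0 = 0.
Proof.
split.
  apply: (@ideal_gen_min _ _ [set p : R | p@_0 = 0]) => [|_ [k _ <-]]; last first.
    by rewrite /= mcoeffX mnm1_eq0.
  split=> //=; first by rewrite mcoeff0.
    by move=> p1 p2 /= p10 p20; rewrite mcoeffD p10 p20 addr0.
  by move=> r p1 _ p10; rewrite rmorphM /= p10 mulr0.
move=> p0; apply: mpoly_ideal_supp => [|a ap]; first exact: ideal_gen_ideal.
have : a != 0%MM by apply: contraTneq ap => ->; rewrite mcoeff_msupp p0 eqxx.
rewrite -mdeg_eq0 mdegE sum_nat_eq0 => /forallPn[k /= ak].
rewrite -(@submK _ U_(k) a) ?lep1mP // mpolyXD.
apply: (idealMl _ (ideal_gen_ideal _)); apply: sub_ideal_gen; exists k => //.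
Qed.

Lemma monomial_sub_maximal I : monomial_ideal I -> I <> setT -> I `<=` @maximal_ideal K d.
Proof.
move=> mI nT p /(monomial_ideal_supp p mI) Ip; apply/maximal_idealP/eqP.
rewrite mcoeff_eq0; apply/negP => /Ip; rewrite mpolyX0 => I1.
by apply/nT/ideal_setT => //; apply: monomial_is_ideal.
Qed.

Lemma maximal_ideal_power (q : nat) p : maximal_ideal p ->
  exists N (a : 'I_d -> R), p ^+ N = \sum_(k < d) 'X_k ^+ q * a k :> R.
Proof.
move=> /maximal_idealP p0; exists (d * q).+1.
apply: (mpoly_ideal_supp (lincomb_ideal _)) => a aN.
have : ((d * q).+1 <= mdeg a)%N.
  elim: (_.+1) a aN => [//|N IH] a; rewrite exprS.
  move=> /msuppM_le /allpairsP[[b c] /= [bp /IH cN ->]].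
  rewrite mdegD -add1n leq_add // lt0n mdeg_eq0.
  by apply: contraTneq bp => ->; rewrite mcoeff_msupp p0 eqxx.
rewrite mdegE => aN'; have [k qk] : exists k, (q <= a k)%N.
  apply/existsP; apply: contraTT aN' => /existsPn ltq.
  rewrite -leqNgt -[d in (d * q)%N]card_ord -sum_nat_const leq_sum // => k _.
  by rewrite ltnW // ltnNge ltq.
have -> : 'X_[a] = 'X_[(a - U_(k) *+ q)] * ('X_k ^+ q) :> R.
  rewrite mpolyXn -mpolyXD submK //; apply/mnm_lepP => l.
  by rewrite mulmnE mnm1E; case: eqP => [<-|]; rewrite ?mul1n ?mul0n.
apply: (idealMl _ (lincomb_ideal _)); exact: lincomb_mem.
Qed.

End MonomialIdeals.

Section RootMaps.
Variables (K : fieldType) (d m : nat).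
Hypothesis m_gt0 : (0 < m)%N.
Notation R := {mpoly K[d]}.
Implicit Types (p q r : R) (a b c e : 'X_{1..d}).

Lemma root_inclE p :
  root_incl m p = mmap (@mpolyC d K) (fun k => 'X_k ^+ m) p.
Proof.
apply: eq_bigr => a _; rewrite mul_mpolyC /mmap1; congr (_ *: _).
rewrite mpolyXE_id; apply: eq_bigr => k _.
by rewrite -exprM mulmnE mulnC.
Qed.

Lemma root_inclD p q : root_incl m (p + q) = root_incl m p + root_incl m q.
Proof. by rewrite !root_inclE raddfD. Qed.

Lemma root_incl0 : root_incl m (0 : R) = 0.
Proof. by rewrite root_inclE raddf0. Qed.

Lemma root_incl_sum (I : Type) (s : seq I) (P : pred I) (f : I -> R) :
  root_incl m (\sum_(i <- s | P i) f i) = \sum_(i <- s | P i) root_incl m (f i).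
Proof. by rewrite root_inclE raddf_sum; apply: eq_bigr => i _; rewrite root_inclE. Qed.

Lemma root_inclM p q : root_incl m (p * q) = root_incl m p * root_incl m q.
Proof. by rewrite !root_inclE rmorphM. Qed.

Lemma root_incl_sign n p : root_incl m ((-1) ^+ n * p) = (-1) ^+ n * root_incl m p.
Proof. by rewrite !root_inclE rmorphMsign. Qed.

Lemma root_inclX a : root_incl m ('X_[a] : R) = 'X_[a *+ m].
Proof. by rewrite /root_incl msuppX big_seq1 mcoeffX eqxx scale1r. Qed.

Lemma root_inclZ (x : K) p : root_incl m (x *: p) = x *: root_incl m p.
Proof. by rewrite !root_inclE mmapZ mul_mpolyC. Qed.

Lemma msupp_root_incl p b : b \in msupp (root_incl m p) ->
  exists2 a, a \in msupp p & b = (a *+ m)%MM.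
Proof.
move=> /msupp_sum_le /flattenP[s /mapP[a]]; rewrite mem_filter => /andP[_ ap] ->.
by move=> /msuppZ_le; rewrite msuppX mem_seq1 => /eqP->; exists a.
Qed.

Lemma root_projX c : root_proj m ('X_[c] : R) =
  if [forall k, (m %| c k)%N] then 'X_[[multinom (c k %/ m)%N | k < d]] else 0.
Proof.
rewrite /root_proj msuppX big_mkcond big_seq1 mcoeffX eqxx scale1r.
by [].
Qed.

Lemma mcoeff_root_proj p a : (root_proj m p)@_a = p@_(a *+ m).
Proof.
rewrite [in RHS](mpolyE p) !raddf_sum /= big_mkcond /=; apply: eq_bigr => b _.
case: ifP => [/forallP mb|/negbT nmb].
  rewrite !mcoeffZ !mcoeffX; congr (_ * _%:R); congr nat_of_bool; apply/eqP/eqP => [<-|->].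
    by apply/mnmP => k; rewrite mulmnE mnmE divnK.
  by apply/mnmP => k; rewrite mnmE mulmnE mulnK.
rewrite mcoeffZ mcoeffX [_ == _]negbTE ?mulr0 //; apply: contra nmb => /eqP->.
by apply/forallP => k; rewrite mulmnE dvdn_mull.
Qed.

Lemma root_projD p q : root_proj m (p + q) = root_proj m p + root_proj m q.
Proof. by apply/mpolyP => a; rewrite mcoeffD !mcoeff_root_proj mcoeffD. Qed.

Lemma root_proj0 : root_proj m (0 : R) = 0.
Proof. by apply/mpolyP => a; rewrite mcoeff_root_proj !mcoeff0. Qed.

Lemma root_projB p q : root_proj m (p - q) = root_proj m p - root_proj m q.
Proof. by apply/mpolyP => a; rewrite mcoeffB !mcoeff_root_proj mcoeffB. Qed.

Lemma root_projZ (x : K) p : root_proj m (x *: p) = x *: root_proj m p.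
Proof. by apply/mpolyP => a; rewrite mcoeffZ !mcoeff_root_proj mcoeffZ. Qed.

Lemma root_proj_sum (I : Type) (s : seq I) (P : pred I) (f : I -> R) :
  root_proj m (\sum_(i <- s | P i) f i) = \sum_(i <- s | P i) root_proj m (f i).
Proof. exact: (big_morph _ root_projD root_proj0). Qed.

Lemma root_proj_sign n p : root_proj m ((-1) ^+ n * p) = (-1) ^+ n * root_proj m p.
Proof.
rewrite -signr_odd !mulr_sign; case: odd => //.
by rewrite -[- p]sub0r root_projB root_proj0 sub0r.
Qed.

Lemma root_projM p q : root_proj m (root_incl m p * q) = p * root_proj m q.
Proof.
elim/mpolyind: p => [|x a p _ _ IH]; first by rewrite root_incl0 !mul0r root_proj0.
rewrite root_inclD !mulrDl root_projD IH; congr (_ + _).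
rewrite root_inclZ -!scalerAl root_projZ; congr (_ *: _).
elim/mpolyind: q {IH} => [|y b q _ _ IHq]; first by rewrite root_proj0 !mulr0 root_proj0.
rewrite mulrDr !root_projD mulrDr IHq; congr (_ + _).
rewrite -scalerAr !root_projZ -scalerAr; congr (_ *: _).
rewrite root_inclX -mpolyXD !root_projX.
have -> : [forall k, m %| (a *+ m + b)%MM k]%N = [forall k, m %| b k]%N.
  by apply: eq_forallb => k; rewrite mnmDE mulmnE dvdn_addr // dvdn_mull.
case: ifP => [_|_]; last by rewrite mulr0.
rewrite -mpolyXD; congr 'X_[_]; apply/mnmP => k.
by rewrite mnmDE !mnmE mulmnE divnMDl.
Qed.

Lemma root_inclK p : root_proj m (root_incl m p) = p.
Proof.
rewrite -[root_incl m p]mulr1 root_projM.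
suff -> : root_proj m (1 : R) = 1 by rewrite mulr1.
apply/mpolyP => a; rewrite mcoeff_root_proj !mcoeff1; congr (_%:R); congr nat_of_bool.
apply/eqP/eqP => [/mnmP am|->]; apply/mnmP => k; rewrite ?mulmnE !mnm0E //.
by have := am k; rewrite mulmnE mnm0E => /eqP; rewrite muln_eq0 orbC eqn0Ngt m_gt0 => /eqP.
Qed.

Lemma msupp_root_proj p a : (a \in msupp (root_proj m p)) = ((a *+ m)%MM \in msupp p).
Proof. by rewrite !mcoeff_msupp mcoeff_root_proj. Qed.

End RootMaps.

(** * Depth *)

Section DepthTransfer.
Variables (K : fieldType) (d : nat).
Notation R := {mpoly K[d]}.
Implicit Types (I J : set R) (t : seq R).

Definition has_regular_seq I r := exists t,
  [/\ size t = r, forall s, s \in t -> maximal_ideal s & regular_seq I t].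

Lemma maximal_ideal_is_ideal : is_ideal (@maximal_ideal K d).
Proof. exact: ideal_gen_ideal. Qed.

Lemma maximal_ideal_proper : ~ maximal_ideal (1 : R).
Proof. by rewrite maximal_idealP mcoeff1 eqxx => /eqP; rewrite oner_eq0. Qed.

Lemma maximal_idealX k : maximal_ideal ('X_k : R).
Proof. by apply: sub_ideal_gen; exists k. Qed.

Lemma has_regular_seq_kvanish I r q : is_ideal I -> has_regular_seq I r ->
  forall i, (i < r)%N -> kvanish (fun k : 'I_d => 'X_k ^+ q) I i.
Proof.
move=> iI [t [<- tM treg]]; apply: regular_kvanish treg _ => // s /tM.
exact: maximal_ideal_power.
Qed.

Lemma kvanish_has_regular_seq I r : monomial_ideal I -> I <> setT ->
  (forall i, (i < r)%N -> kvanish (fun k : 'I_d => 'X_k) I i) -> has_regular_seq I r.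
Proof.
move=> mI nT; apply: kvanish_regular (maximal_ideal_proper) _ => //.
- exact: noetherian_mpoly.
- exact: monomial_is_ideal.
- exact: maximal_ideal_is_ideal.
- exact: maximal_idealX.
- exact: monomial_sub_maximal.
Qed.

Lemma has_regular_seq_le I r r' : monomial_ideal I -> I <> setT -> (r' <= r)%N ->
  has_regular_seq I r -> has_regular_seq I r'.
Proof.
move=> mI nT r'r /(@has_regular_seq_kvanish _ _ 1 (monomial_is_ideal mI)) van.
apply: kvanish_has_regular_seq => // i ir'.
exact: van _ (leq_trans ir' r'r).
Qed.

Lemma has_regular_seq_dim I r : monomial_ideal I -> I <> setT ->
  has_regular_seq I r -> (r <= d)%N.
Proof.
move=> mI nT /(@has_regular_seq_kvanish _ _ 1 (monomial_is_ideal mI)) van.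
rewrite leqNgt; apply/negP => /van /(_ (fun=> 1))[|b bI].
  move=> G; rewrite -[d in RHS]card_ord => Gd.
  by have := max_card (mem G); rewrite Gd ltnn.
have /bI /(monomial_sub_maximal mI nT) M1 : #|[set: 'I_d]%SET| = d by rewrite cardsT card_ord.
apply: maximal_ideal_proper; apply: idealBr M1; first exact: maximal_ideal_is_ideal.
apply: ideal_sum => [|k _]; first exact: maximal_ideal_is_ideal.
apply: (idealMl _ maximal_ideal_is_ideal); apply: (idealMr _ maximal_ideal_is_ideal).
exact: maximal_idealX.
Qed.

Lemma root_incl_kdiff m (c : {set 'I_d} -> R) (y : 'I_d -> R) G :
  root_incl m (kdiff y c G) =
  kdiff (fun k => root_incl m (y k)) (fun F => root_incl m (c F)) G.
Proof.
by rewrite /kdiff root_incl_sum; apply: eq_bigr => k _; rewrite root_incl_sign root_inclM.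
Qed.

Lemma root_proj_kdiff m (c : {set 'I_d} -> R) (y : 'I_d -> R) G : (0 < m)%N ->
  root_proj m (kdiff (fun k => root_incl m (y k)) c G) =
  kdiff y (fun F => root_proj m (c F)) G.
Proof.
move=> m0; rewrite /kdiff root_proj_sum //; apply: eq_bigr => k _.
by rewrite root_proj_sign // root_projM.
Qed.

Lemma root_incl_ideal I J m p : monomial_ideal I -> is_ideal J ->
  (forall a, I 'X_[a] -> J 'X_[(a *+ m)]) -> I p -> J (root_incl m p).
Proof.
move=> mI iJ IJ /(monomial_ideal_supp p mI) Ip; apply: mpoly_ideal_supp => // b.
by move=> /msupp_root_incl[a /Ip Ia ->]; apply: IJ.
Qed.

Lemma root_proj_ideal I J m p : (0 < m)%N -> is_ideal I -> monomial_ideal J ->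
  (forall a, J 'X_[(a *+ m)] -> I 'X_[a]) -> J p -> I (root_proj m p).
Proof.
move=> m0 iI mJ JI /(monomial_ideal_supp p mJ) Jp; apply: mpoly_ideal_supp => // a.
by rewrite msupp_root_proj // => /Jp /JI.
Qed.

(* R / I is a direct summand of R^(1/m) / J^(1/m); a regular sequence on the  *)
(* latter need not come from R, hence the detour through Koszul cohomology.   *)
Lemma has_regular_seq_root I J m r : (0 < m)%N -> monomial_ideal I -> monomial_ideal J ->
  I <> setT -> (forall a, I 'X_[a] <-> J 'X_[(a *+ m)]) ->
  has_regular_seq J r -> has_regular_seq I r.
Proof.
move=> m0 mI mJ nT IJ /(@has_regular_seq_kvanish _ _ m (monomial_is_ideal mJ)) van.
have [iI iJ] := (monomial_is_ideal mI, monomial_is_ideal mJ).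
have yE : (fun k : 'I_d => 'X_k ^+ m) = (fun k => root_incl m ('X_k : R)).
  by apply/funext => k; rewrite root_inclX mpolyXn.
apply: kvanish_has_regular_seq => // i ir c cI.
have [|b bJ] := van i ir (fun F => root_incl m (c F)).
  move=> G Gi; rewrite yE -root_incl_kdiff.
  by apply: (root_incl_ideal mI iJ) (cI G Gi) => a /IJ.
exists (fun F => root_proj m (b F)) => F Fi.
rewrite -root_proj_kdiff // -[c F](root_inclK m0) -root_projB //.
by apply: (root_proj_ideal m0 iI mJ) => [a /IJ//|]; rewrite -yE; apply: bJ.
Qed.

Lemma depth_proper (RR : realType) I r : monomial_ideal I -> I <> setT ->
  has_regular_seq I r -> ~ has_regular_seq I r.+1 -> depth RR I = r%:R%:E.
Proof.
move=> mI nT Ir nIr; rewrite /depth /depth_quotient; case: asboolP => [IMT|_].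
  exfalso; apply: maximal_ideal_proper.
  have : ideal_gen (I `|` @maximal_ideal K d) 1 by rewrite IMT.
  apply: ideal_gen_min; first exact: maximal_ideal_is_ideal.
  by move=> p [|//]; apply: monomial_sub_maximal.
apply/eqP; rewrite eq_le; apply/andP; split.
  apply: ge_ereal_sup => _ [s [sM sreg] <-]; rewrite lee_fin ler_nat leqNgt.
  apply/negP => rs; apply: nIr; apply: has_regular_seq_le rs _ => //.
  by exists s.
by apply: ereal_sup_ubound; have [s [<- sM sreg]] := Ir; exists s.
Qed.

Lemma depth_setT (RR : realType) : depth RR [set: R] = +oo%E.
Proof.
rewrite /depth /depth_quotient; case: asboolP => // nT; exfalso; apply: nT.
by apply: ideal_setT; [exact: ideal_gen_ideal | apply: sub_ideal_gen; left].
Qed.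

Lemma depth_stable (RR : realType) (I : nat -> set R) :
  (forall n, monomial_ideal (I n)) -> (forall n, I n.+1 <> setT) ->
  (forall n, exists N0, forall N, (N0 <= N)%N -> exists2 m, (0 < m)%N &
     forall a, I n.+1 'X_[a] <-> I N.+1 'X_[(a *+ m)]) ->
  exists r N0, forall N, (N0 <= N)%N -> depth RR (I N) = r%:R%:E.
Proof.
move=> mI nT tr.
pose P r := forall n, has_regular_seq (I n.+1) r.
have P0 : P 0%N by move=> n; exists [::]; split=> //; apply/regular_seq_nil => //;
  apply: monomial_is_ideal.
have Pd : ~ P d.+1.
  by move=> /(_ 0%N) /(has_regular_seq_dim (mI _) (nT _)); rewrite ltnn.
have [r [Pr nPr]] : exists r, P r /\ ~ P r.+1.
  apply: contrapT => /forallNP step; apply: Pd.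
  elim: (d.+1) => // r Pr; apply: contrapT => nPr; exact: (step r).
have /existsNP[n nPn] := nPr; have [N0 trN] := tr n.
exists r, N0.+1 => -[//|N]; rewrite ltnS => N0N.
apply: (depth_proper _ (mI _) (nT _) (Pr N)).
have [m m0 IJ] := trN N N0N.
by move=> /(has_regular_seq_root m0 (mI _) (mI _) (nT _) IJ).
Qed.

End DepthTransfer.

(** * Asymptotically stable filtrations *)

Section StableFiltrations.
Variables (K : fieldType) (d : nat).
Notation R := {mpoly K[d]}.
Variable I : nat -> set R.
Hypotheses (filI : filtration I) (mI : forall n, monomial_ideal (I n)).
Implicit Types (a b c : 'X_{1..d}).

Lemma filtration_le m n : (m <= n)%N -> I n `<=` I m.
Proof.
have [_ _ dec _] := filI; elim: n => [|n IH]; first by rewrite leqn0 => /eqP ->.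
rewrite leq_eqVlt => /predU1P[->//|/IH sub].
exact: subset_trans (dec n) sub.
Qed.

Lemma filtration_pow n k p : I n p -> I (k * n)%N (p ^+ k).
Proof.
have [_ I0 _ mul] := filI => Ip; elim: k => [|k IH]; first by rewrite mul0n I0.
by rewrite mulSn exprS; apply: mul.
Qed.

Hypothesis stabI : asymptotically_stable I.

(* (qa, N+1) in the Rees semigroup gives (kqa, k(qn+1)); for m = m_f large    *)
(* and k = m %/ q this forces (ma, mn+1) to be in the semigroup.              *)
Lemma stable_multiple q n N a : (0 < q)%N -> (N < q * n.+1)%N -> (q * n <= N)%N ->
  I n.+1 'X_[a] <-> I N.+1 'X_[(a *+ q)].
Proof.
move=> q0 Nq qN; split=> [/(filtration_pow q)|IN].
  by rewrite mpolyXn; apply: filtration_le.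
have [_ [mf [mf0 unb stab]]] := stabI.
have [f mB] := unb (q * (q * n + 2))%N; set m := mf f in mB.
have [|_ proj] := stab n f 1%N; first by rewrite leqnn mf0.
rewrite -[X in I _ X](root_inclK (mf0 f)); apply: proj; exists (root_incl (mf f) 'X_[a]) => //.
move=> b; rewrite root_inclX msuppX mem_seq1 => /eqP-> {b}; rewrite -/m.
have /(filtration_pow (m %/ q)) : I (q * n).+1 'X_[(a *+ q)].
  by apply: filtration_le IN; rewrite ltnS.
rewrite mpolyXn => /(filtration_le _) => /(_ (n * m + 1)%N) Iq.
apply: (@monomial_ideal_le _ _ _ (a *+ q *+ (m %/ q))%MM).
- exact: monomial_is_ideal.
- by apply/mnm_lepP => k; rewrite !mulmnE -mulnA leq_mul2l mulnC leq_divM orbT.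
apply: Iq; have mE := divn_eq m q; have rq := ltn_pmod m q0.
by nia.
Qed.

Lemma stable_stretch n N : (n.+1 * n.+2 <= N)%N ->
  exists q, [/\ (0 < q)%N, (N < q * n.+1)%N, (q * n.+1 <= N + n.+1)%N &
    forall a, I n.+1 'X_[a] <-> I N.+1 'X_[(a *+ q)]].
Proof.
move=> nN; pose q := (N %/ n.+1).+1.
have Nq : (N < q * n.+1)%N by rewrite ltn_ceil.
have qN : (q * n.+1 <= N + n.+1)%N by rewrite mulSn addnC leq_add2r leq_divM.
exists q; split=> // a; apply: stable_multiple => //.
by nia.
Qed.

Lemma rees_ideal : ideal_in (rees_algebra I) [set p | rees_algebra I p /\ p`_0 = 0].
Proof.
have idI n := monomial_is_ideal (mI n); have [_ _ _ mul] := filI.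
split=> [p []//||p q [Ip p0] [Iq q0]|s p Is [Ip p0]].
- by split=> [n|]; rewrite coef0 //; apply: ideal0.
- by split=> [n|]; rewrite coefD ?p0 ?q0 ?addr0 //; apply: idealD.
split=> [n|]; last by rewrite coefM big_ord1 p0 mulr0.
rewrite coefM; apply: ideal_sum => // -[i /= i_n] _.
by rewrite -[X in I X](@subnKC i) //; apply: mul.
Qed.

Lemma rees_degree_bound : exists D, forall n a, I n 'X_[a] ->
  exists b, [/\ (b <= a)%MM, I n 'X_[b] & forall k, (b k <= D * n)%N].
Proof.
have [noeth _] := stabI; have [s [sJ sgen]] := noeth _ rees_ideal.
have [idI I0 _ mul] := filI.
pose D := (\sum_(p <- s) \sum_(n < size p) \sum_(b <- msupp p`_n) mdeg b)%N.
have sD p n b k : p \in s -> b \in msupp p`_n -> (b k <= D)%N.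
  move=> ps bp; have np : (n < size p)%N.
    by rewrite ltnNge; apply/negP => /(nth_default 0) p0; rewrite p0 msupp0 in bp.
  apply: (@leq_trans (mdeg b)); first by rewrite mdegE (bigD1 k) //= leq_addr.
  rewrite /D (big_rem p) //= (bigD1 (Ordinal np)) //= (big_rem b) //=.
  by rewrite -!addnA leq_addr.
exists D; elim/ltn_ind => n IH a Ia.
have [n0|n0] := posnP n.
  exists 0%MM; split=> [||k]; last by rewrite mnm0E.
    by apply/mnm_lepP => k; rewrite mnm0E.
  by rewrite n0 I0.
have [|c [cI pE]] := sgen ('X_[a] *: 'X^n).
  split=> [i|]; last by rewrite coefZ coefXn eq_sym (gtn_eqF n0) mulr0.
  rewrite coefZ coefXn; case: eqP => [->|_]; first by rewrite mulr1.
  by rewrite mulr0; apply: ideal0.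
have : a \in msupp ('X_[a] *: 'X^n : {poly R})`_n.
  by rewrite coefZ coefXn eqxx mulr1 msuppX mem_head.
rewrite pE coef_sum => /msupp_sum_le /flattenP[_ /mapP[k _ ->]].
rewrite coefM => /msupp_sum_le /flattenP[_ /mapP[[i /= i_n] _ ->]].
move=> /msuppM_le /allpairsP[[b e] /= [bc es ->]].
have ks : s`_k \in s by apply: mem_nth.
have [sI s0] := sJ _ ks.
have i_lt_n : (i < n)%N.
  rewrite ltn_neqAle -ltnS i_n andbT; apply: contraTneq es => ->.
  by rewrite subnn s0 msupp0.
have Ib : I i 'X_[b] by move/(monomial_ideal_supp _ (mI i)): (cI k i); apply.
have Ie : I (n - i)%N 'X_[e] by move/(monomial_ideal_supp _ (mI (n - i)%N)): (sI (n - i)%N); apply.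
have [b' [b'b Ib' b'D]] := IH i i_lt_n b Ib.
exists (b' + e)%MM; split=> [||l].
- by apply/mnm_lepP => l; rewrite !mnmDE leq_add2r; apply/mnm_lepP.
- by rewrite mpolyXD -[X in I X](@subnKC i) //; apply: mul.
rewrite mnmDE (leq_trans (leq_add (b'D l) (sD _ _ _ l ks es))) //.
by rewrite -mulnSr leq_mul2l i_lt_n orbT.
Qed.

End StableFiltrations.

(** * Local cohomology of monomial ideals *)

Section CechCochains.
Variables (K : fieldType) (d : nat).
Notation R := {mpoly K[d]}.
Notation tofrac := (@FracField.tofrac R).
Implicit Types (I J : set R) (p q : R) (a b : 'X_{1..d}) (F G : {set 'I_d}).

Definition mpow F n : 'X_{1..d} := [multinom ((k \in F) * n)%N | k < d].
Definition mcst n : 'X_{1..d} := [multinom n | k < d].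

Lemma var_prodXn F n : var_prod K F ^+ n = 'X_[mpow F n].
Proof.
rewrite /var_prod big_mkcond -prodrXl mpolyXE_id; apply: eq_bigr => k _.
by rewrite mnmE; case: (k \in F); rewrite ?mul1n ?mul0n ?expr0 ?expr1n.
Qed.

Lemma mcstD m n : mcst (m + n) = (mcst m + mcst n)%MM.
Proof. by apply/mnmP => k; rewrite mnmDE !mnmE. Qed.

Lemma mdeg_mcst n : mdeg (mcst n) = (n * d)%N.
Proof.
rewrite mdegE (eq_bigr (fun=> n)) => [|k _]; last by rewrite mnmE.
by rewrite sum_nat_const card_ord mulnC.
Qed.

Lemma mdeg_mpow F n : mdeg (mpow F n) = (n * #|F|)%N.
Proof.
rewrite mdegE (eq_bigr (fun k => if k \in F then n else 0%N)) => [|k _].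
  by rewrite -big_mkcond sum_nat_const mulnC.
by rewrite mnmE; case: (k \in F); rewrite ?mul1n ?mul0n.
Qed.

Lemma mpolyX_neq0 a : 'X_[a] != 0 :> R.
Proof. by apply/eqP => /mpolyP/(_ a)/eqP; rewrite mcoeffX eqxx mcoeff0 oner_eq0. Qed.

Lemma tofracX_neq0 a : tofrac 'X_[a] != 0.
Proof. by rewrite tofrac_eq0 mpolyX_neq0. Qed.

Lemma eq_tofrac_div p q a b :
  (tofrac p / tofrac 'X_[a] == tofrac q / tofrac 'X_[b]) = (p * 'X_[b] == q * 'X_[a]).
Proof. by rewrite eqr_div ?tofracX_neq0 // -!tofracM tofrac_eq. Qed.

(* x^(a - N) lies in the localization of I at x_F, with (x_F)^M as            *)
(* denominator; the inequality avoids negative exponents.                     *)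
Definition in_local I F N M a :=
  exists2 b, I 'X_[b] & forall k, (b k + N <= a k + (k \in F) * M)%N.

Definition local_numerator I F (j : int) N p :=
  homogeneous_of (j + (N * d)%:Z) p /\
  exists M, forall a, a \in msupp p -> in_local I F N M a.

Lemma localizationP I F j N p : monomial_ideal I ->
  localization I F j (tofrac p / tofrac 'X_[mcst N]) <-> local_numerator I F j N p.
Proof.
move=> mI; have iI := monomial_is_ideal mI; split.
  move=> [q [n [Iq hq /eqP]]].
  rewrite -tofracXn var_prodXn eq_tofrac_div => /eqP pq.
  have key a : a \in msupp p ->
      exists2 b, b \in msupp q & (a + mpow F n = b + mcst N)%MM.
    move=> ap; have : (mpow F n + a)%MM \in msupp (p * 'X_[mpow F n]).
      by rewrite (perm_mem (msuppMX _ _)) map_f.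
    rewrite pq (perm_mem (msuppMX _ _)) => /mapP[b bq abE]; exists b => //.
    by rewrite addmC abE addmC.
  split=> [a /key[b bq abE]|].
    have /(congr1 (@mdeg d)) := abE; rewrite !mdegD mdeg_mcst mdeg_mpow.
    by have := hq b bq; lia.
  exists n => a /key[b bq /mnmP abE].
  exists b => [|k]; first by move/(monomial_ideal_supp q mI): Iq; apply.
  by have := abE k; rewrite !mnmDE !mnmE => ->.
move=> [hp [M pM]].
pose f a := (a + mpow F M - mcst N)%MM.
have fE a : a \in msupp p -> (f a + mcst N = a + mpow F M)%MM.
  move=> /pM[b _ bM]; rewrite /f submK //; apply/mnm_lepP => k.
  by rewrite mnmDE !mnmE; apply: leq_trans (bM k); rewrite leq_addl.
exists (\sum_(a <- msupp p) p@_a *: 'X_[f a]), M; split.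
- rewrite big_seq; apply: ideal_sum => // a ap; rewrite -mul_mpolyC; apply: idealMl => //.
  have [b Ib bM] := pM a ap; apply: monomial_ideal_le Ib => //; apply/mnm_lepP => k.
  by rewrite /f mnmBE mnmDE !mnmE -(leq_add2r N) subnK // (leq_trans (leq_addl _ _) (bM k)).
- move=> e /msupp_sum_le /flattenP[s /mapP[a]]; rewrite mem_filter => /andP[_ ap] ->.
  move=> /msuppZ_le; rewrite msuppX mem_seq1 => /eqP->.
  have /(congr1 (@mdeg d)) := fE a ap; rewrite !mdegD mdeg_mcst mdeg_mpow.
  by have := hp a ap; lia.
apply/eqP; rewrite -tofracXn var_prodXn eq_tofrac_div mulr_suml [X in X * _]mpolyE mulr_suml.
rewrite big_seq [X in _ == X]big_seq; apply/eqP; apply: eq_bigr => a ap.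
by rewrite -!scalerAl -!mpolyXD fE.
Qed.

Lemma localization_numerator I F j z : localization I F j z ->
  exists N, forall N', (N <= N')%N -> exists p, z = tofrac p / tofrac 'X_[mcst N'].
Proof.
move=> [q [n [_ _ ->]]]; exists n => N' nN'; exists (q * 'X_[(mcst N' - mpow F n)]).
apply/eqP; rewrite -tofracXn var_prodXn eq_tofrac_div -mulrA -mpolyXD submK //.
by apply/mnm_lepP => k; rewrite !mnmE; case: (k \in F); rewrite ?mul1n ?mul0n.
Qed.

Lemma cochain_numerators I (P : pred {set 'I_d}) j c :
  (forall F, P F -> localization I F j (c F)) ->
  exists N, forall N', (N <= N')%N -> exists p : {set 'I_d} -> R,
    forall F, P F -> c F = tofrac (p F) / tofrac 'X_[mcst N'].
Proof.
move=> cP.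
have /choice[N NP] : forall F, exists N, P F -> forall N', (N <= N')%N ->
    exists p, c F = tofrac p / tofrac 'X_[mcst N'].
  move=> F; have [/cP/localization_numerator[N NP]|//] := boolP (P F); first by exists N.
  by exists 0%N.
exists (\sum_F N F)%N => N' NN'.
have /choice[p pP] : forall F, exists p, P F -> c F = tofrac p / tofrac 'X_[mcst N'].
  move=> F; have [PF|//] := boolP (P F); last by exists 0.
  have [|p pE] := NP F PF N'; last by exists p.
  by apply: leq_trans NN'; rewrite (bigD1 F) //= leq_addr.
by exists p.
Qed.

Lemma cech_diff_numerator c (p : {set 'I_d} -> R) G a :
  (forall F, #|F|.+1 = #|G| -> c F = tofrac (p F) / tofrac 'X_[a]) ->
  cech_diff c G = tofrac (kdiff (fun=> 1) p G) / tofrac 'X_[a].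
Proof.
move=> cp; rewrite /cech_diff /kdiff rmorph_sum mulr_suml; apply: eq_bigr => k kG.
rewrite cp; last by rewrite [RHS](cardsD1 k) kG.
by rewrite mul1r rmorphMsign mulrA.
Qed.

Lemma local_cohomology_neq0P I i j : monomial_ideal I ->
  local_cohomology_neq0 I i j <-> exists N (p : {set 'I_d} -> R),
   [/\ forall F, #|F| = i -> local_numerator I F j N (p F),
       forall G, #|G| = i.+1 -> kdiff (fun=> 1) p G = 0 &
       forall n (b : {set 'I_d} -> R),
         (forall F, #|F|.+1 = i -> local_numerator I F j (N + n) (b F)) ->
         ~ forall F, #|F| = i -> p F * 'X_[mcst n] = kdiff (fun=> 1) b F].
Proof.
move=> mI; split.
  move=> [c [cI cc cb]].
  have [F /eqP|N /(_ N (leqnn N))[p cp]] := @cochain_numerators I (fun F => #|F| == i) j c.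
    exact: cI.
  have {}cp F : #|F| = i -> c F = tofrac (p F) / tofrac 'X_[mcst N] by move/eqP; apply: cp.
  exists N, p; split.
  - by move=> F Fi; apply/localizationP => //; rewrite -cp //; apply: cI.
  - move=> G Gi; have /eqP := cc G Gi; rewrite (@cech_diff_numerator _ p _ (mcst N)).
      by rewrite mulf_eq0 invr_eq0 (negPf (tofracX_neq0 _)) orbF tofrac_eq0 => /eqP.
    by rewrite Gi => F [Fi]; apply: cp.
  move=> n b bI pb; apply: cb; exists (fun F => tofrac (b F) / tofrac 'X_[mcst (N + n)]).
  split=> F Fi; first by apply/localizationP => //; apply: bI.
  rewrite (@cech_diff_numerator _ b _ (mcst (N + n))) // cp // -pb //.
  by apply/eqP; rewrite eq_tofrac_div mcstD mpolyXD mulrA mulrAC.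
move=> [N [p [pI pc pb]]].
exists (fun F => tofrac (p F) / tofrac 'X_[mcst N]); split.
- by move=> F Fi; apply/localizationP => //; apply: pI.
- by move=> G Gi; rewrite (@cech_diff_numerator _ p _ (mcst N)) // pc // tofrac0 mul0r.
move=> [b [bI cb]].
have [F /eqP|N' /(_ (N + N')%N (leq_addl _ _))[b' bb']] :=
  @cochain_numerators I (fun F => #|F|.+1 == i) j b; first exact: bI.
have {}bb' F : #|F|.+1 = i -> b F = tofrac (b' F) / tofrac 'X_[mcst (N + N')].
  by move/eqP; apply: bb'.
apply: (pb N' b') => F Fi.
  by apply/localizationP => //; rewrite -bb' //; apply: bI.
have /eqP := cb F Fi; rewrite (@cech_diff_numerator _ b' _ (mcst (N + N'))); last first.
  by move=> G; rewrite Fi; apply: bb'.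
rewrite eq_tofrac_div mcstD mpolyXD mulrA mulrAC => /eqP pE.
by apply: (mulIf (mpolyX_neq0 (mcst N))).
Qed.

End CechCochains.

Section LocalCohomology.
Variables (K : fieldType) (d : nat).
Notation R := {mpoly K[d]}.
Implicit Types (I J : set R) (p : R) (a b : 'X_{1..d}) (F G : {set 'I_d}).

Lemma mcst_mulm n m : (mcst d n *+ m)%MM = mcst d (n * m).
Proof. by apply/mnmP => k; rewrite mulmnE !mnmE. Qed.

Lemma root_incl1 m : root_incl m (1 : R) = 1.
Proof. by rewrite -mpolyX0 root_inclX; congr 'X_[_]; apply/mnmP => k; rewrite mulmnE mnm0E. Qed.

Lemma mulX_numerator I F j N p n : local_numerator I F j N p ->
  local_numerator I F j (N + n) (p * 'X_[mcst d n]).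
Proof.
move=> [hp [M pM]]; split=> [a|].
  rewrite (perm_mem (msuppMX _ _)) => /mapP[b /hp bj ->].
  by rewrite mdegD mdeg_mcst; lia.
exists M => a; rewrite (perm_mem (msuppMX _ _)) => /mapP[b /pM[e Ie eM] ->].
by exists e => // k; rewrite mnmDE mnmE; have := eM k; set u := (_ * M)%N; lia.
Qed.

Lemma local_cohomology_root I J q i j : (0 < q)%N ->
  monomial_ideal I -> monomial_ideal J ->
  (forall a, I 'X_[a] <-> J 'X_[(a *+ q)]) ->
  local_cohomology_neq0 I i j -> local_cohomology_neq0 J i (j * q%:Z).
Proof.
move=> q0 mI mJ IJ /(local_cohomology_neq0P _ _ mI)[N [p [pI pc pb]]].
apply/local_cohomology_neq0P => //.
have kdE (c : {set 'I_d} -> R) G : root_incl q (kdiff (fun=> 1) c G) =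
    kdiff (fun=> 1) (fun F => root_incl q (c F)) G.
  by rewrite root_incl_kdiff root_incl1.
exists (N * q)%N, (fun F => root_incl q (p F)); split.
- move=> F /pI[hp [M pM]]; split=> [b /msupp_root_incl[a /hp aj ->]|].
    by rewrite mdegMn; lia.
  exists (M * q)%N => b /msupp_root_incl[a /pM[e Ie eM] ->].
  exists (e *+ q)%MM => [|k]; first exact/IJ.
  by rewrite !mulmnE mulnA -!mulnDl leq_mul2r eM orbT.
- by move=> G /pc pG; rewrite -kdE pG root_incl0.
move=> n b bJ pbE.
pose b' F := b F * 'X_[mcst d (n * q - n)].
have nq : (n * q - n + n = n * q)%N by rewrite subnK // leq_pmulr.
have b'J F : #|F|.+1 = i -> local_numerator J F (j * q%:Z) ((N + n) * q) (b' F).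
  move=> /bJ /(@mulX_numerator _ _ _ _ _ (n * q - n)); congr local_numerator.
  by rewrite mulnDl -addnA [(n + _)%N]addnC nq.
apply: (pb n (fun F => root_proj q (b' F))) => F Fi.
  have [hb [M bM]] := b'J F Fi; split=> [a|].
    by rewrite msupp_root_proj // => /hb; rewrite mdegMn; nia.
  exists M => a; rewrite msupp_root_proj // => /bM[e Je eM].
  have le k : ((N + n) <= a k + (k \in F) * M)%N.
    rewrite -(leq_pmul2r q0); apply: leq_trans (leq_trans (leq_addl _ _) (eM k)) _.
    by rewrite mulmnE mulnDl leq_add2l leq_pmulr.
  exists (a + mpow F M - mcst d (N + n))%MM => [|k]; last first.
    by rewrite mnmBE mnmDE !mnmE subnK.
  apply/IJ; apply: monomial_ideal_le Je; first exact: monomial_is_ideal.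
  apply/mnm_lepP => k; rewrite mulmnE mnmBE mnmDE !mnmE mulnBl leq_subRL; last first.
    by rewrite leq_mul2r le orbT.
  rewrite addnC (leq_trans (eM k)) // mulmnE mulnDl leq_add2l.
  exact: leq_pmulr.
rewrite -[LHS](root_inclK q0) root_inclM root_inclX mcst_mulm -nq mcstD mpolyXD.
rewrite [X in _ * X]mulrC mulrA pbE // mulrC -kdiffZ.
rewrite -[(fun=> 1) in LHS](_ : (fun k : 'I_d => root_incl q (1 : R)) = _); last first.
  by apply/funext => k; rewrite root_incl1.
rewrite root_proj_kdiff //; apply: eq_kdiff => G _.
by rewrite /b' mulrC.
Qed.

Lemma kdiff_khomotopy_cocycle (A : comNzRingType) (y : 'I_d -> A) k c i F :
  (forall G, #|G| = i.+1 -> kdiff y c G = 0) -> #|F| = i ->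
  kdiff y (khomotopy k c) F = y k * c F.
Proof.
move=> c0 Fi; rewrite -kdiff_khomotopy /khomotopy; case: ifP => kF; rewrite ?addr0 //.
by rewrite c0 ?mulr0 ?addr0 // cardsU1 kF Fi.
Qed.

Definition mfilter (P : pred 'X_{1..d}) p : R := \sum_(a <- msupp p | P a) p@_a *: 'X_[a].

Lemma mcoeff_mfilter P p a : (mfilter P p)@_a = if P a then p@_a else 0.
Proof.
rewrite [p in RHS]mpolyE /mfilter big_mkcond !raddf_sum /=; case: ifP => Pa.
  apply: eq_bigr => b _; case: ifP => // nPb.
  rewrite mcoeff0 mcoeffZ mcoeffX; case: eqP => [ba|]; last by rewrite mulr0.
  by rewrite ba Pa in nPb.
rewrite big1 // => b _; case: ifP => Pb; rewrite ?mcoeff0 //.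
rewrite mcoeffZ mcoeffX; case: eqP => [ba|]; last by rewrite mulr0.
by rewrite ba Pa in Pb.
Qed.

Lemma msupp_mfilter P p a : (a \in msupp (mfilter P p)) = P a && (a \in msupp p).
Proof. by rewrite !mcoeff_msupp mcoeff_mfilter; case: (P a); rewrite //= eqxx. Qed.

Lemma kdiff_mfilter P (c : {set 'I_d} -> R) G :
  kdiff (fun=> 1) (fun F => mfilter P (c F)) G = mfilter P (kdiff (fun=> 1) c G).
Proof.
apply/mpolyP => a; rewrite mcoeff_mfilter /kdiff !raddf_sum /=; case: ifP => Pa.
  apply: eq_bigr => k _; rewrite !mul1r -signr_odd !mulr_sign; case: odd => /=;
  by rewrite ?mcoeffN mcoeff_mfilter Pa.
apply: big1 => k _; rewrite mul1r -signr_odd mulr_sign; case: odd => /=;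
by rewrite ?mcoeffN mcoeff_mfilter Pa ?oppr0.
Qed.

(* In the direction of a variable x_k the Cech complex is constant on the     *)
(* degrees a with a_k >= rho, hence contractible there.                       *)
Lemma local_cohomology_bound I rho i j : monomial_ideal I ->
  (forall a, I 'X_[a] -> exists b, [/\ (b <= a)%MM, I 'X_[b] & forall k, (b k <= rho)%N]) ->
  local_cohomology_neq0 I i j -> j <= (d * rho)%:Z.
Proof.
move=> mI bnd /(local_cohomology_neq0P _ _ mI)[N [p [pI pc pb]]].
have iI := monomial_is_ideal mI.
rewrite leNgt; apply/negP => jrho.
pose big a := [pick k | (rho + N < a k)%N].
pose c k F := mfilter (fun a => big a == Some k) (p F).
apply: (pb 0%N (fun F => \sum_k khomotopy k (c k) F)); last first.
  move=> F Fi; rewrite kdiff_sum.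
  rewrite (eq_bigr (fun k => c k F)) => [|k _]; last first.
    rewrite (@kdiff_khomotopy_cocycle _ _ _ _ i) ?mul1r // => G /pc pG.
    by rewrite kdiff_mfilter pG /mfilter msupp0 big_nil.
  rewrite (_ : mcst d 0 = 0%MM) ?mpolyX0 ?mulr1; last by apply/mnmP => k; rewrite !mnmE.
  apply/mpolyP => a; rewrite raddf_sum /=.
  under eq_bigr => k _ do rewrite mcoeff_mfilter.
  have [ap|/memN_msupp_eq0 ->] := boolP (a \in msupp (p F)); last first.
    by rewrite big1 // => k _; case: ifP.
  rewrite /big; case: pickP => [k _|small].
    rewrite (bigD1 k) //= eqxx big1 ?addr0 // => l lk.
    by rewrite (inj_eq Some_inj) eq_sym (negPf lk).
  have [hp _] := pI F Fi; have := hp a ap; rewrite mdegE => adeg.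
  have : (\sum_k a k <= \sum_(k < d) (rho + N))%N.
    by apply: leq_sum => k _; rewrite leqNgt small.
  rewrite sum_nat_const card_ord => asum; exfalso; move: jrho adeg asum; lia.
move=> F Fi; rewrite addn0.
have cI k a : a \in msupp (khomotopy k (c k) F) ->
    [/\ k \notin F, (rho + N < a k)%N & a \in msupp (p (k |: F))].
  rewrite /khomotopy; case: ifP => kF; first by rewrite msupp0.
  rewrite -signr_odd mulr_sign => ac; have : a \in msupp (c k (k |: F)).
    by move: ac; case: odd => //; rewrite (perm_mem (msuppN _)).
  rewrite msupp_mfilter /big => /andP[]; case: pickP => // l la /eqP[<-]; split=> //.
have num k : k \notin F -> local_numerator I (k |: F) j N (p (k |: F)).
  by move=> kF; apply: pI; rewrite cardsU1 kF.
split=> [a /msupp_sum_le /flattenP[s /mapP[k _ ->] /cI[kF _ ap]]|].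
  by have [hp _] := num k kF; apply: hp.
have /choice[M MP] : forall k, exists M, k \notin F ->
    forall a, a \in msupp (p (k |: F)) -> in_local I (k |: F) N M a.
  by move=> k; have [kF|/num[_ [M MP]]] := boolP (k \in F); [exists 0%N | exists M].
exists (\sum_k M k)%N => a /msupp_sum_le /flattenP[s /mapP[k _ ->] /cI[kF ak ap]].
have [e Ie eM] := MP k kF a ap; have [b [be Ib brho]] := bnd e Ie.
exists b => // l; have [->|lk] := eqVneq l k.
  by have := brho k; set u := (_ * _)%N; lia.
apply: leq_trans (leq_trans _ (eM l)) _; first by rewrite leq_add2r; apply/mnm_lepP.
rewrite !inE (negPf lk) /= leq_add2l leq_mul2l (bigD1 k) //= leq_addr.
by rewrite orbT.
Qed.

Lemma local_cohomology_le_dim I i j : is_ideal I ->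
  local_cohomology_neq0 I i j -> (i <= d)%N.
Proof.
move=> iI [c [_ _ cb]]; rewrite leqNgt; apply/negP => di; apply: cb.
exists (fun=> 0); split=> F Fi.
  by exists 0, 0%N; split=> [||]; [exact: ideal0 | move=> a; rewrite msupp0 |
    rewrite tofrac0 mul0r].
by have := max_card (mem F); rewrite card_ord Fi leqNgt di.
Qed.

Lemma local_cohomology_top I : monomial_ideal I -> I <> [set 0] ->
  local_cohomology_neq0 I d (- d%:Z).
Proof.
move=> mI I0; apply/local_cohomology_neq0P => //.
have iI := monomial_is_ideal mI.
have [b Ib] : exists b, I 'X_[b].
  apply: contrapT => /forallNP nI; apply: I0; apply/seteqP; split=> [p|_ ->]; last exact: ideal0.
  move=> /(monomial_ideal_supp p mI) Ip; apply/eqP; rewrite -msupp_eq0.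
  by case: (msupp p) Ip => // a s /(_ a (mem_head _ _)) /nI.
exists 1%N, (fun=> 1); split.
- move=> F Fd; split=> [a|]; first by rewrite msupp1 mem_seq1 => /eqP->; rewrite mdeg0; lia.
  exists (mdeg b).+1 => a; rewrite msupp1 mem_seq1 => /eqP->.
  have FT : F = [set: 'I_d]%SET.
    by apply/eqP; rewrite eqEcard finset.subsetT cardsT card_ord Fd leqnn.
  exists b => // k; rewrite FT inE mnm0E mul1n add0n addn1 ltnS.
  by rewrite mdegE (bigD1 k) //= leq_addr.
- by move=> G Gd; have := max_card (mem G); rewrite card_ord Gd ltnn.
move=> n c cI /(_ [set: 'I_d]%SET); rewrite cardsT card_ord => /(_ erefl) E.
have /eqP : ((1 : R) * 'X_[mcst d n])@_(mcst d n) = 0.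
  rewrite E /kdiff raddf_sum big1 // => k _ /=; rewrite mul1r -signr_odd mulr_sign.
  suff /memN_msupp_eq0 c0 : mcst d n \notin msupp (c ([set: 'I_d]%SET :\ k)).
    by case: odd; rewrite ?mcoeffN c0 ?oppr0.
  have [|_ [M cM]] := cI ([set: 'I_d]%SET :\ k).
    by rewrite -[RHS]card_ord -cardsT [RHS](cardsD1 k) inE.
  apply/negP => /cM[e _ /(_ k)]; rewrite !inE eqxx mul0n mnmE; lia.
by rewrite mul1r mcoeffX eqxx oner_eq0.
Qed.

End LocalCohomology.

(** * Regularity *)

Section Dimension.
Variables (K : fieldType) (d : nat) (RR : realType).
Notation R := {mpoly K[d]}.
Implicit Types (I : set R) (p : R).

Definition kill_vars n : R -> R :=
  mmap (@mpolyC d K) (fun l : 'I_d => if (l < n)%N then 0 else 'X_l).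

Lemma kill_varsX n (l : 'I_d) : kill_vars n 'X_l = if (l < n)%N then 0 else 'X_l.
Proof. by rewrite /kill_vars mmapX mmap1U. Qed.

Lemma kill_vars_comp n p : kill_vars n.+1 (kill_vars n p) = kill_vars n.+1 p.
Proof.
rewrite {2 3}/kill_vars /mmap [LHS]raddf_sum; apply: eq_bigr => a _ /=.
rewrite [LHS]rmorphM /= [mmap _ _ _%:MP]mmapC /mmap1 [in LHS]rmorph_prod; congr (_ * _).
apply: eq_bigr => l _; rewrite [LHS]rmorphXn; congr (_ ^+ _).
case: ltnP => [ln|nl]; last exact: kill_varsX.
by rewrite [LHS]raddf0 (leq_trans ln).
Qed.

Lemma kill_vars_chain n : (n <= d)%N ->
  prime_chain [set (0 : R)] n (fun k => [set p | kill_vars k p = 0]).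
Proof.
move=> nd; split=> [k _|k kn]; last first.
  split=> [p /= p0|]; first by rewrite -kill_vars_comp p0 [LHS]raddf0.
  have kd := leq_trans kn nd; move=> /(_ 'X_(Ordinal kd)) /=.
  rewrite !kill_varsX /= ltnSn ltnn => /(_ erefl) /eqP.
  by rewrite (negPf (mpolyX_neq0 _ _)).
split=> [|_ ->]; last exact: raddf0.
split=> [|/=|p q /=].
- split=> // [|p q /= p0 q0|a p _ /= p0]; first exact: raddf0.
    by rewrite [LHS]raddfD /= [X in X + _]p0 [X in _ + X]q0 addr0.
  by rewrite [LHS]rmorphM /= [X in _ * X]p0 mulr0.
- by rewrite [kill_vars k 1]rmorph1 => /eqP; rewrite oner_eq0.
by rewrite [kill_vars k (p * q)]rmorphM => /eqP; rewrite mulf_eq0 => /orP[]/eqP; [left|right].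
Qed.

Lemma annihilator_neq0 I : is_ideal I -> I <> [set 0] -> annihilator I = [set 0].
Proof.
move=> iI I0; apply/seteqP; split=> [r rI|_ -> p _]; last by rewrite mul0r.
apply: contrapT => r0; apply: I0; apply/seteqP; split=> [p Ip|_ ->]; last exact: ideal0.
have /eqP := rI p Ip; rewrite mulf_eq0 => /orP[/eqP//|/eqP//].
Qed.

Lemma le_dim_module I i : is_ideal I -> I <> [set 0] -> (i <= d)%N ->
  (i%:R%:E <= dim_module RR I)%E.
Proof.
move=> iI I0 id; rewrite /dim_module annihilator_neq0 //.
apply: ereal_sup_ubound; exists i => //.
by exists (fun k => [set p | kill_vars k p = 0]); apply: kill_vars_chain.
Qed.

Lemma reg_eq0 : reg RR [set (0 : R)] = -oo%E.
Proof.
rewrite /reg (_ : [set i | _] = set0) ?image_set0 ?ereal_sup0 //.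
apply/seteqP; split=> // i /=; apply/negP; rewrite -ltNge.
suff -> : dim_module RR [set (0 : R)] = -oo%E by rewrite ltNyr.
rewrite /dim_module /dim_quotient (_ : [set n | _] = set0) ?image_set0 ?ereal_sup0 //.
apply/seteqP; split=> // n [P [/(_ 0%N isT)[[_ P1 _] annP] _]].
by apply/P1/annP => p ->; rewrite mulr0.
Qed.

Lemma le_reg I i j : is_ideal I -> I <> [set 0] -> local_cohomology_neq0 I i j ->
  ((j%:~R + i%:R)%:E <= reg RR I)%E.
Proof.
move=> iI I0 lc; have id := local_cohomology_le_dim iI lc.
apply: (@le_trans _ _ (a_invariant RR I i + i%:R%:E)%E).
  by rewrite EFinD leeD2r //; apply: ereal_sup_ubound; exists j.
by apply: ereal_sup_ubound; exists i => //=; apply: le_dim_module.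
Qed.

Lemma reg_le I (B : RR) :
  (forall i j, local_cohomology_neq0 I i j -> j%:~R + i%:R <= B) -> (reg RR I <= B%:E)%E.
Proof.
move=> lcB; apply: ge_ereal_sup => _ [i _ <-]; rewrite -leeBrDr //.
apply: ge_ereal_sup => _ [j lc <-]; rewrite -EFinB lee_fin lerBrDr.
exact: lcB.
Qed.

End Dimension.

Lemma archi_inv (RR : realType) (x e : RR) : 0 <= x -> 0 < e ->
  exists N0, forall N, (N0 <= N)%N -> x / N.+1%:R <= e.
Proof.
move=> x0 e0; exists (Num.bound (x / e)) => N bN.
rewrite ler_pdivrMr ?ltr0n // -ler_pdivrMl // mulrC ltW //.
apply: lt_le_trans (archi_boundP _) _; first by rewrite divr_ge0 // ltW.
by rewrite ler_nat (leq_trans bN).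
Qed.

Section RegularityLimit.
Import numFieldNormedType.Exports.
Variables (RR : realType) (K : fieldType) (d : nat) (I : nat -> set {mpoly K[d]}).
Hypotheses (filI : filtration I) (mI : forall n, monomial_ideal (I n)).
Hypotheses (stabI : asymptotically_stable I) (I0 : forall n, I n <> [set 0]).

(* The limit is the supremum of j / n over all H^i(I_n)_j != 0 with n > 0: by *)
(* local_cohomology_root each such j / n is approached by the classes         *)
(* H^i(I_N)_(qj) with q close to N / n.                                       *)
Lemma reg_limit : exists l : RR,
  (fun n : nat => reg RR (I n) * (n%:R^-1)%:E)%E @ \oo --> l%:E.
Proof.
have idI n := monomial_is_ideal (mI n).
have [D Dbnd] := rees_degree_bound filI mI stabI.
have lcD n i j : local_cohomology_neq0 (I n) i j -> j <= (d * (D * n))%:Z.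
  by apply: local_cohomology_bound => // a /Dbnd.
pose S := [set x : RR | exists n i j, local_cohomology_neq0 (I n.+1) i j /\
  x = j%:~R / n.+1%:R].
have supS : has_sup S.
  split.
    by exists ((- d%:Z)%:~R / 1%:R), 0%N, d, (- d%:Z); split=> //; apply: local_cohomology_top.
  exists (d * D)%:R => _ [n [i [j [/lcD jD ->]]]].
  rewrite ler_pdivrMr ?ltr0n // -natrM -mulnA -[X in _ <= X]/((d * (D * n.+1))%:Z%:~R).
  by rewrite ler_int.
pose L := sup S.
have jL n i j : local_cohomology_neq0 (I n.+1) i j -> j%:~R <= L * n.+1%:R.
  move=> lc; rewrite -ler_pdivrMr ?ltr0n //; apply: sup_upper_bound => //.
  by exists n, i, j.
have ubreg n : (reg RR (I n.+1) <= (L * n.+1%:R + d%:R)%:E)%E.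
  apply: reg_le => i j lc; rewrite lerD ?ler_nat ?(jL _ i) //.
  exact: local_cohomology_le_dim lc.
have lbreg n : (0%:E <= reg RR (I n.+1))%E.
  have := @le_reg K d RR (I n.+1) d (- d%:Z) (idI _) (@I0 _)
    (local_cohomology_top (mI _) (@I0 _)).
  by rewrite mulrNz pmulrn addNr.
have finreg n : reg RR (I n.+1) \is a fin_num.
  by rewrite fin_numE gt_eqF ?(lt_le_trans (ltNyr 0) (lbreg n)) //
     lt_eqF // (le_lt_trans (ubreg n) (ltry _)).
have finE n : reg RR (I n.+1) = (fine (reg RR (I n.+1)))%:E by rewrite fineK.
exists L; apply/fine_cvgP; split.
  by exists 1%N => // -[//|n] _ /=; rewrite finE -EFinM.
apply/cvgrPdist_le => e e0.
have e20 : 0 < e / 2 by rewrite divr_gt0.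
have [_ [n [i [j [lc ->]]]] Lj] := sup_adherent e20 supS.
have [N1 N1P] := archi_inv (ler0n RR d) e0.
have [N2 N2P] := archi_inv (normr_ge0 (j%:~R : RR)) e20.
exists (maxn (n.+1 * n.+2) (maxn N1 N2)).+1 => // -[//|N] /=; rewrite ltnS !geq_max.
move=> /and3P[nN N1N N2N]; rewrite finE -EFinM /=.
set r := fine _; have N0 : 0 < N.+1%:R :> RR by rewrite ltr0n.
have rU : r <= L * N.+1%:R + d%:R by rewrite -lee_fin -finE.
have [q [q0 qN qN' tr]] := stable_stretch filI mI stabI nN.
have rL : j%:~R * q%:R <= r.
  rewrite -lee_fin -finE; apply: le_trans (le_reg RR (idI _) (@I0 _)
    (local_cohomology_root q0 (mI _) (mI _) tr lc)).
  by rewrite lee_fin intrM lerDl.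
have n0 : 0 < n.+1%:R :> RR by rewrite ltr0n.
have jq : j%:~R / n.+1%:R * N.+1%:R - `|j%:~R| <= r.
  apply: le_trans rL; rewrite lerBlDr -lerBlDl mulrAC -mulrA -mulrBr.
  apply: le_trans (ler_norm _) _; rewrite normrM ler_piMr // ler_norml.
  have {}qN : N.+1%:R <= q%:R * n.+1%:R :> RR by rewrite -natrM ler_nat.
  have {}qN' : q%:R * n.+1%:R <= N.+1%:R + n.+1%:R :> RR.
    by rewrite -natrM -natrD ler_nat (leq_trans qN') // leq_add2r.
  have : N.+1%:R / n.+1%:R <= q%:R :> RR by rewrite ler_pdivrMr.
  have : q%:R - 1 <= N.+1%:R / n.+1%:R :> RR by rewrite ler_pdivlMr // mulrBl mul1r lerBlDr.
  by move: (_ / _) => x qx xq; apply/andP; split; lra.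
rewrite ler_distl; apply/andP; split.
  rewrite lerBlDr ler_pdivrMr // (le_trans rU) // mulrDl lerD2l.
  by rewrite -ler_pdivrMr // N1P.
have {}jq : j%:~R / n.+1%:R <= r / N.+1%:R + `|j%:~R| / N.+1%:R.
  by rewrite -mulrDl ler_pdivlMr // -lerBlDr.
have := N2P N N2N; move: Lj jq; rewrite -/L.
by set x := r / N.+1%:R; set y := _ / n.+1%:R; set z := _ / N.+1%:R; lra.
Qed.

End RegularityLimit.

(* The sequences take values in the extended reals so that the degenerate     *)
(* cases reg(0) = -oo and depth(0) = +oo are covered; outside of them the     *)
(* limits are real numbers.                                                   *)
Theorem theorem4p6 (RR : realType) (K : fieldType) (d : nat)
    (I : nat -> set {mpoly K[d]}) :
  filtration I -> (forall n, monomial_ideal (I n)) ->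
  asymptotically_stable I ->
  (exists l : \bar RR,
     (fun n : nat => reg RR (I n) * (n%:R^-1)%:E)%E @ \oo --> l /\
     ((forall n, I n <> [set 0]) -> l \is a fin_num)) /\
  (exists l : \bar RR,
     (fun n : nat => depth RR (I n)) @ \oo --> l /\
     ((forall n, (0 < n)%N -> I n <> setT) -> l \is a fin_num)).
Proof.
move=> filI mI stabI; split.
  have [nz|/existsNP[n /contrapT In0]] := pselect (forall n, I n <> [set 0]).
    by have [l lP] := reg_limit RR filI mI stabI nz; exists l%:E.
  exists -oo%E; split=> [|/(_ n In0)//]; apply: cvg_near_cst.
  exists n.+1 => // N /= nN.
  have -> : I N = [set 0].
    apply/seteqP; split=> [p|_ ->]; last by apply: ideal0; apply: monomial_is_ideal.
    by rewrite -In0; apply: filtration_le => //; apply: ltnW.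
  by rewrite reg_eq0 gt0_mulNye // lte_fin invr_gt0 ltr0n (leq_ltn_trans _ nN).
have [pr|/existsNP[n /not_implyP[n0 /contrapT InT]]] :=
    pselect (forall n, (0 < n)%N -> I n <> setT).
  have [||r [N0 rP]] := @depth_stable K d RR I mI.
  - by move=> n; apply: pr.
  - move=> n; exists (n.+1 * n.+2)%N => N nN.
    by have [q [q0 _ _ tr]] := stable_stretch filI mI stabI nN; exists q.
  exists r%:R%:E; split=> //; apply: cvg_near_cst.
  by exists N0.
exists +oo%E; split=> [|/(_ n n0 InT)//]; apply: cvg_near_cst.
exists 0%N => // N _; rewrite -(depth_setT K d RR); congr depth.
apply: ideal_setT; first exact: monomial_is_ideal.
have I1 : I 1%N 1 by apply: (filtration_le filI n0); rewrite InT.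
by have := filtration_pow filI N I1; rewrite muln1 expr1n.
Qed.
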